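(* Let $(M^n,c,W)$ be a conformal manifold with a CSpin structure and a Weyl structure $W$, and let $w\in\mathbb{R}$. Let $\mathcal{D}$ be the Dirac operator, $\Delta^S$ the spinor Laplacian, $R$ the scalar curvature and $F$ the Faraday curvature of $W$. Then for every $\psi\in\Gamma(S^w)$ $$\mathcal{D}^2\psi=\Delta^S\psi+\frac14 R\,\psi+\left(\frac{n-2+2w}{4}\right)F\cdot\psi .$$
   Context: Setting. $M^n$ is a smooth oriented manifold, $c$ a conformal class of Riemannian metrics, $P$ the corresponding bundle of conformal frames with group $CO(n)_+=SO(n)\times\mathbb{R}_+$. $CSpin(n)=Spin(n)\times\mathbb{R}_+$ covers $CO(n)_+$ two-fold via $\lambda^c(a,t)=t\lambda(a)$, where $\lambda:Spin(n)\to SO(n)$ is the covering. A CSpin structure is a principal $CSpin(n)$-bundle $P_{CSpin}$ on $M$ with a two-fold covering $P_{CSpin}\to P$ compatible with $\lambda^c$ and the group actions. Bundles. $\mathcal{L}^w$ is the real line bundle associated to the representation $(a,t)\mapsto t^w$ (densities of weight $w$). A metric $g\in c$ gives $l_g=|vol_g|^{-1/n}\in\Gamma(\mathcal{L}^1)$. $S^w$ is associated to $\kappa^w(a,t)=t^w\kappa(a)$ on $\Delta_n=\mathbb{C}^{2^{[n/2]}}$, with $\kappa$ the spin representation. $T$ (weight $1$) and $T^*$ (weight $-1$) are the ordinary tangent and cotangent bundles. $c=l_g^2g$ is the conformal inner product $T\otimes T\to\mathcal{L}^2$. Throughout $(e_i)$ denotes a local orthonormal frame of the weightless bundle $T\otimes\mathcal{L}^{-1}$,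 i.e. $e_i=l_g^{-1}\otimes(\text{a } g\text{-orthonormal frame})$, so $c(e_i,e_j)=\delta_{ij}$. Traces are taken with such frames. Clifford product. It is induced from $\mathbb{R}^n\otimes\Delta_n\to\Delta_n$ with $x\cdot x=-|x|^2$; weights add: $T\otimes S^w\to S^{w+1}$, $T^*\otimes S^w\to S^{w-1}$, $e_i\cdot:S^w\to S^w$. For a $2$-form $F$, $F\cdot\psi=\sum_{i,j}F(e_i,e_j)\,e_i\cdot e_j\cdot\psi\in S^{w-2}$ (sum over all $i,j$). Weyl structure. $W$ is a torsion-free connection on $P$; $\nabla$ is the induced covariant derivative on associated bundles, and $\nabla^S$ that on $S^w$ induced by the lift of $W$. For $g\in c$, $\nabla l_g=\theta\otimes l_g$; the Faraday curvature is $F=d\theta$ (the curvature of $\mathcal{L}^1$, independent of $g$). With $\mathcal{R}(X,Y,Z,U)=c(\nabla_X\nabla_YZ-\nabla_Y\nabla_XZ-\nabla_{[X,Y]}Z,U)$, put $Ric(Y,Z)=\sum_i\mathcal{R}(e_i,Y,Z,e_i)$ and $R=\operatorname{tr}Ric\in\Gamma(\mathcal{L}^{-2})$. Operators. $\mathcal{D}:\Gamma(S^w)\to\Gamma(S^{w-1})$, $\mathcal{D}\psi=\sum_i e_i\cdot\nabla^S_{e_i}\psi$. $\Delta^S:\Gamma(S^w)\to\Gamma(S^{w-2})$, $\Delta^S\psi=-\operatorname{tr}\nabla^{T^*\otimes S}\nabla^S\psi$. *)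

(* Defs.v *)
From HB Require Import structures.
From mathcomp Require Import all_boot all_order all_algebra.
From mathcomp Require Import all_classical all_reals all_analysis.
From mathcomp Require Import complex.

Set Implicit Arguments.
Unset Strict Implicit.
Unset Printing Implicit Defensive.
Import Order.TTheory GRing.Theory Num.Theory.
Import numFieldNormedType.Exports.
Local Open Scope classical_set_scope.
Local Open Scope ring_scope.
Local Open Scope complex_scope.

(** * Smooth oriented manifolds *)

Section Euclidean.
Variables (R : realType) (n : nat).

Definition partial (i : 'I_n) (f : 'rV[R]_n -> R) (y : 'rV[R]_n) : R :=
  derive (f : 'rV[R]_n -> R^o) y (delta_mx 0 i).

Fixpoint Ck (k : nat) (O : set 'rV[R]_n) (f : 'rV[R]_n -> R) : Prop :=
  (forall y, O y -> {for y, continuous f}) /\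
  if k is k'.+1 then
    forall i, (forall y, O y ->
                 derivable (f : 'rV[R]_n -> R^o) y (delta_mx 0 i)) /\
              Ck k' O (partial i f)
  else True.

Definition Csmooth (O : set 'rV[R]_n) (f : 'rV[R]_n -> R) : Prop :=
  forall k, Ck k O f.

End Euclidean.

(* [cinv] is only meaningful on the image of [cdom] under [cmap]. *)
Record chart (R : realType) (n : nat) (M : topologicalType) := Chart {
  cdom : set M;
  cmap : M -> 'rV[R]_n;
  cinv : 'rV[R]_n -> M }.

Definition is_chart (R : realType) (n : nat) (M : topologicalType)
    (phi : chart R n M) : Prop :=
  [/\ open (cdom phi), open (cmap phi @` cdom phi),
      forall x, cdom phi x -> cinv phi (cmap phi x) = x,
      forall x, cdom phi x -> {for x, continuous (cmap phi)} &
      forall y, (cmap phi @` cdom phi) y -> {for y, continuous (cinv phi)}].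

Definition transition (R : realType) (n : nat) (M : topologicalType)
    (phi psi : chart R n M) (j : 'I_n) (y : 'rV[R]_n) : R :=
  cmap psi (cinv phi y) 0 j.

Record oriented_manifold (R : realType) (n : nat) := OrientedManifold {
  man_sort :> topologicalType;
  man_hausdorff : hausdorff_space man_sort;
  man_countable : @second_countable man_sort;
  atlas : set (chart R n man_sort);
  atlas_chart : forall phi, atlas phi -> is_chart phi;
  atlas_cover : forall x, exists2 phi, atlas phi & cdom phi x;
  atlas_smooth : forall phi psi j, atlas phi -> atlas psi ->
    Csmooth (cmap phi @` (cdom phi `&` cdom psi)) (transition phi psi j);
  atlas_oriented : forall phi psi y, atlas phi -> atlas psi ->
    (cmap phi @` (cdom phi `&` cdom psi)) y ->
    0 < \det (\matrix_(i, j) partial i (transition phi psi j) y) }.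

Section Manifold.
Variables (R : realType) (n : nat) (M : oriented_manifold R n).

Definition smooth_on (V : set M) (f : M -> R) : Prop :=
  forall phi, atlas phi ->
    Csmooth (cmap phi @` (V `&` cdom phi)) (f \o cinv phi).

Definition smooth_near (x : M) (f : M -> R) : Prop :=
  exists V : set M, [/\ open V, V x & smooth_on V f].

Definition smooth_mx p q (V : set M) (A : M -> 'M[R]_(p, q)) : Prop :=
  forall i j, smooth_on V (fun x => A x i j).

(** ** Tangent vectors, vector fields, Lie bracket *)

Definition tvec := (M -> R) -> R.

(* Derivations at x of the algebra of germs at x of smooth functions.  The
   last field only fixes a value where the derivation is not defined, so that
   two tangent vectors are equal as soon as they agree on germs. *)
Record tangent (x : M) (v : tvec) : Prop := Tangent {
  tangent_germ : forall f g, smooth_near x f ->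
    (\forall y \near x, f y = g y) -> v f = v g;
  tangent_lin : forall a f g, smooth_near x f -> smooth_near x g ->
    v (fun y => a * f y + g y) = a * v f + v g;
  tangent_leibniz : forall f g, smooth_near x f -> smooth_near x g ->
    v (fun y => f y * g y) = v f * g x + f x * v g;
  tangent_out : forall f, ~ smooth_near x f -> v f = 0 }.

Definition vfield := M -> tvec.

Definition smooth_vfield (U : set M) (X : vfield) : Prop :=
  (forall x, U x -> tangent x (X x)) /\
  (forall (V : set M) (f : M -> R), open V -> V `<=` U -> smooth_on V f ->
     smooth_on V (fun x => X x f)).

Definition bracket (X Y : vfield) : vfield := fun x f =>
  if `[< smooth_near x f >]
  then X x (fun y => Y y f) - Y x (fun y => X y f) else 0.

Definition der_mx p q (v : tvec) (A : M -> 'M[R]_(p, q)) : 'M[R]_(p, q) :=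
  \matrix_(i, j) v (fun y => A y i j).

(** ** Conformal structures and conformal frames *)

Definition metric := M -> tvec -> tvec -> R.

Record riemannian (g : metric) : Prop := Riemannian {
  riem_lin : forall x a u v v', tangent x u -> tangent x v -> tangent x v' ->
    g x (fun f => a * v f + v' f) u = a * g x v u + g x v' u;
  riem_sym : forall x u v, tangent x u -> tangent x v -> g x u v = g x v u;
  riem_pos : forall x v, tangent x v -> v <> (fun _ => 0) -> 0 < g x v v;
  riem_smooth : forall U X Y, open U -> smooth_vfield U X ->
    smooth_vfield U Y -> smooth_on U (fun x => g x (X x) (Y x)) }.

Definition conformal_class (c : set metric) : Prop :=
  exists2 g0, riemannian g0 &
    forall g, c g <-> riemannian g /\
      exists2 f : M -> R, smooth_on setT f &
        forall x u v, tangent x u -> tangent x v ->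
          g x u v = expR (2 * f x) * g0 x u v.

Definition frame := 'I_n -> tvec.

(* u_j . A = \sum_i u_i A_ij *)
Definition frame_act (u : frame) (A : 'M[R]_n) : frame :=
  fun j f => \sum_i u i f * A i j.

(* The group CO(n)_+ = SO(n) x R_+, with (A, t) written as the matrix tA. *)
Definition COp (A : 'M[R]_n) : Prop :=
  exists t (O : 'M[R]_n),
    [/\ 0 < t, O^T *m O = 1%:M, \det O = 1 & A = t *: O].

(* Its Lie algebra so(n) + R, and the two components of an element. *)
Definition co_lie (B : 'M[R]_n) : Prop := exists a : R, B + B^T = a%:M.
Definition co_tr (B : 'M[R]_n) : R := \tr B / n%:R.
Definition co_so (B : 'M[R]_n) : 'M[R]_n := B - (co_tr B)%:M.

Variable c : set metric.

(* The fibre over x of the bundle P of oriented conformal frames: for one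
   (hence every) metric of c the u_i are orthogonal and of equal length. *)
Definition conf_frame (x : M) (u : frame) : Prop :=
  [/\ forall i, tangent x (u i),
      forall phi, atlas phi -> cdom phi x ->
        0 < \det (\matrix_(i, j) u i (fun y => cmap phi y 0 j)) &
      forall g, c g -> exists2 t, 0 < t &
        forall i j, g x (u i) (u j) = t ^+ 2 *+ (i == j)].

(* Smooth local sections of P. *)
Definition frame_field (U : set M) (e : M -> frame) : Prop :=
  [/\ open U, forall x, U x -> conf_frame x (e x) &
      forall i, smooth_vfield U (fun x => e x i)].

(* The vector field with components z in the frame field e. *)
Definition vf_of (e : M -> frame) (z : M -> 'cV[R]_n) : vfield :=
  fun x f => \sum_k z x k 0 * e x k f.

(** ** Weyl structures *)

(* A connection on P, given by its pullbacks [cform e] along the smooth local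
   sections e of P. *)
Record connection := Connection {
  cform :> (M -> frame) -> M -> tvec -> 'M[R]_n;
  cform_co : forall U e x v, frame_field U e -> U x -> tangent x v ->
    co_lie (cform e x v);
  cform_lin : forall U e x a v v', frame_field U e -> U x ->
    tangent x v -> tangent x v' ->
    cform e x (fun f => a * v f + v' f) = a *: cform e x v + cform e x v';
  cform_smooth : forall U e X, frame_field U e -> smooth_vfield U X ->
    smooth_mx U (fun x => cform e x (X x));
  cform_gauge : forall U e U' e' (V : set M) (A : M -> 'M[R]_n),
    frame_field U e -> frame_field U' e' ->
    open V -> V `<=` U `&` U' -> smooth_mx V A ->
    (forall y, V y -> COp (A y) /\ e' y = frame_act (e y) (A y)) ->
    forall x v, V x -> tangent x v ->
    cform e' x v =
      invmx (A x) *m cform e x v *m A x + invmx (A x) *m der_mx v A }.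

(* Sections of the bundle associated to a representation r are handled through
   their components in all local gauges: for e' = e.A, these are related by
   z_e' = r(A)^-1 z_e, and \nabla_X z = X z + r_*(cform e X) z.  Here r is the
   standard representation, i.e. the bundle is T. *)
Definition covT (W : connection) (e : M -> frame) (X : vfield)
    (z : M -> 'cV[R]_n) : M -> 'cV[R]_n :=
  fun x => der_mx (X x) z + W e x (X x) *m z x.

Definition torsion_free (W : connection) : Prop :=
  forall U e (y z : M -> 'cV[R]_n), frame_field U e ->
    smooth_mx U y -> smooth_mx U z -> forall x, U x ->
    (fun f => vf_of e (covT W e (vf_of e y) z) x f
            - vf_of e (covT W e (vf_of e z) y) x f)
      = bracket (vf_of e y) (vf_of e z) x.

Record weyl_structure := WeylStructure {
  weyl_conn :> connection;
  weyl_torsion : torsion_free weyl_conn }.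

Variable W : weyl_structure.

(** ** Curvature *)

Definition curvT (e : M -> frame) (X Y : vfield) (z : M -> 'cV[R]_n) :
    M -> 'cV[R]_n :=
  fun x => covT W e X (covT W e Y z) x - covT W e Y (covT W e X z) x
           - covT W e (bracket X Y) z x.

(* The constant components of the k-th vector of the frame field e; they
   describe e_k both as a section of T (a conformal vector field) and, T \otimes
   L^-1 being trivialised by e too, as the orthonormal weightless frame. *)
Definition bas (k : 'I_n) : M -> 'cV[R]_n := fun _ => delta_mx k 0.
Definition fr_vf (e : M -> frame) (k : 'I_n) : vfield := fun x => e x k.

(* The conformal inner product T \otimes T -> L^2 in a conformal gauge. *)
Definition cprod (y z : 'cV[R]_n) : R := \sum_k y k 0 * z k 0.

Definition Riem (e : M -> frame) (i j k l : 'I_n) (x : M) : R :=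
  cprod (curvT e (fr_vf e i) (fr_vf e j) (bas k) x) (bas l x).
Definition Ric (e : M -> frame) (j k : 'I_n) (x : M) : R :=
  \sum_i Riem e i j k i x.
Definition scal (e : M -> frame) (x : M) : R := \sum_j Ric e j j x.

(** ** Densities and the Faraday curvature *)

(* \nabla on the density bundle L^w. *)
Definition covL (w : R) (e : M -> frame) (X : vfield) (f : M -> R) : M -> R :=
  fun x => X x f + w * co_tr (W e x (X x)) * f x.

(* The section |vol_g|^(-1/n) of L^1; |vol_g (e_1, .., e_n)| is the square
   root of the Gram determinant. *)
Definition lg (g : metric) (e : M -> frame) (x : M) : R :=
  Num.sqrt (\det (\matrix_(i, j) g x (e x i) (e x j))) `^ (- n%:R^-1).

Definition theta (g : metric) (e : M -> frame) (X : vfield) : M -> R :=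
  fun x => covL 1 e X (lg g e) x / lg g e x.

Definition faraday (g : metric) (e : M -> frame) (X Y : vfield) : M -> R :=
  fun x => X x (theta g e Y) - Y x (theta g e X) - theta g e (bracket X Y) x.

End Manifold.

(** * The groups Spin(n), CSpin(n) and the spin representation *)

Section Clifford.
Variables (R : realType) (n : nat).

(* The real Clifford algebra of R^n with x * x = - |x|^2, in the basis
   e_S = e_i1 * .. * e_ik for S = {i1 < .. < ik}: one has
   e_S * e_T = (-1)^N e_(S symmetric difference T), where N is the number of
   pairs (s, t) in S x T with t <= s (a swap if t < s, a square if t = s). *)
Definition cliff := {ffun {set 'I_n} -> R}.

Definition cl_sign (S T : {set 'I_n}) : R :=
  (-1) ^+ #|[pred p : 'I_n * 'I_n | [&& p.1 \in S, p.2 \in T & (p.2 <= p.1)%N]]|.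

Definition cl_mul (a b : cliff) : cliff :=
  [ffun U : {set 'I_n} => \sum_(S : {set 'I_n})
     \sum_(T : {set 'I_n} | (S :\: T) :|: (T :\: S) == U)
       cl_sign S T * a S * b T].

Definition cl_one : cliff := [ffun S => (S == finset.set0)%:R].

Definition cl_vec (x : 'cV[R]_n) : cliff :=
  [ffun S => \sum_i x i 0 *+ (S == [set i]%SET)].

Definition unit_vec (x : 'cV[R]_n) : Prop := \sum_i x i 0 ^+ 2 = 1.

Definition Spin (a : cliff) : Prop :=
  exists s : seq 'cV[R]_n,
    [/\ forall x, x \in s -> unit_vec x, ~~ odd (size s) &
        a = foldr (fun x => cl_mul (cl_vec x)) cl_one s].

(* A = \lambda(a), i.e. a * x * a^-1 = A x for all vectors x. *)
Definition spin_cov (a : cliff) (A : 'M[R]_n) : Prop :=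
  forall x, cl_mul a (cl_vec x) = cl_mul (cl_vec (A *m x)) a.

Definition cspin := (cliff * R)%type.
Definition CSpin (h : cspin) : Prop := Spin h.1 /\ 0 < h.2.
Definition cs_one : cspin := (cl_one, 1).
Definition cs_mul (h k : cspin) : cspin := (cl_mul h.1 k.1, h.2 * k.2).

(* The inverse so(n) -> spin(n) of the differential of \lambda, which maps a
   in spin(n) = span (e_i * e_j, i < j) to x |-> a * x - x * a. *)
Definition spin_lie (B : 'M[R]_n) : cliff :=
  [ffun S => 4^-1 * \sum_k \sum_l B l k *
     cl_mul (cl_vec (delta_mx k 0)) (cl_vec (delta_mx l 0)) S].

Notation spinor := ('cV[R[i]]_(2 ^ n./2)).
Notation spinor_mx := ('M[R[i]]_(2 ^ n./2)).

Variable gam : 'I_n -> spinor_mx.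

Definition cmul (x : 'cV[R]_n) : spinor_mx := \sum_i (x i 0)%:C *: gam i.

(* A complex representation of the Clifford algebra on \Delta_n; for
   dimension reasons it is irreducible, so its restriction to Spin(n) is the
   spin representation. *)
Definition clifford_rep : Prop :=
  forall x, cmul x *m cmul x = - (\sum_i x i 0 ^+ 2)%:C%:M.

(* The linear extension to the Clifford algebra of the spin representation;
   it is also the differential of the latter on spin(n).  The product is taken
   in increasing order of the indices. *)
Definition kappa (a : cliff) : spinor_mx :=
  \sum_(S : {set 'I_n})
    (a S)%:C *: \big[mulmx/1%:M]_(i <- enum S) gam i.

Definition kappaw (w : R) (h : cspin) : spinor_mx :=
  (h.2 `^ w)%:C *: kappa h.1.

(* The differential of kappaw w, on co(n) identified with the Lie algebra of
   CSpin(n) by the differential of the covering. *)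
Definition dkappaw (w : R) (B : 'M[R]_n) : spinor_mx :=
  kappa (spin_lie (co_so B)) + (w * co_tr B)%:C%:M.

End Clifford.

Notation spinor R n := ('cV[R[i]]_(2 ^ n./2)).
Notation spinor_mx R n := ('M[R[i]]_(2 ^ n./2)).

(** * CSpin structures and spinor fields *)

Section CSpinStructure.
Variables (R : realType) (n : nat) (M : oriented_manifold R n).
Variable c : set (metric M).

Definition smooth_transition (T : Type) (act : T -> cspin R n -> T)
    (V : set M) (s s' : M -> T) : Prop :=
  exists h : M -> cspin R n,
    [/\ forall x, V x -> CSpin (h x) /\ s' x = act (s x) (h x),
        forall S, smooth_on V (fun x => (h x).1 S) &
        smooth_on V (fun x => (h x).2)].

(* A principal CSpin(n)-bundle is given by its total space, projection, right
   action and smooth local sections; the latter determine the topology and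
   the smooth structure of the total space.  [sec_max] says that all smooth
   local sections are present.  The map [cov] to the bundle P of conformal
   frames is two-fold since it is equivariant for CSpin(n) -> CO(n)_+. *)
Record cspin_structure := CSpinStructure {
  tot :> Type;
  proj : tot -> M;
  act : tot -> cspin R n -> tot;
  proj_act : forall q h, CSpin h -> proj (act q h) = proj q;
  act_one : forall q, act q (cs_one R n) = q;
  act_mul : forall q h k, CSpin h -> CSpin k ->
    act (act q h) k = act q (cs_mul h k);
  act_fibre : forall q q', proj q = proj q' ->
    exists! h, CSpin h /\ q' = act q h;
  sec : set M -> (M -> tot) -> Prop;
  sec_open : forall U s, sec U s -> open U;
  sec_proj : forall U s, sec U s -> forall x, U x -> proj (s x) = x;
  sec_cover : forall x, exists U s, sec U s /\ U x;
  sec_smooth : forall U s U' s', sec U s -> sec U' s' ->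
    smooth_transition act (U `&` U') s s';
  sec_max : forall U' s', open U' -> (forall x, U' x -> proj (s' x) = x) ->
    (forall U s, sec U s -> smooth_transition act (U `&` U') s s') -> sec U' s';
  cov : tot -> frame M;
  cov_frame : forall q, conf_frame c (proj q) (cov q);
  cov_act : forall q a t A, CSpin (a, t) -> spin_cov a A ->
    cov (act q (a, t)) = frame_act (cov q) (t *: A);
  cov_smooth : forall U s, sec U s -> frame_field c U (fun x => cov (s x)) }.

Variables (Q : cspin_structure) (W : weyl_structure c).
Variable gam : 'I_n -> spinor_mx R n.

Definition der_spinor (v : tvec M) (f : M -> spinor R n) : spinor R n :=
  \col_k (v (fun y => complex.Re (f y k 0)) +i* v (fun y => complex.Im (f y k 0))).

Definition smooth_spinor (V : set M) (f : M -> spinor R n) : Prop :=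
  forall k, smooth_on V (fun x => complex.Re (f x k 0)) /\
            smooth_on V (fun x => complex.Im (f x k 0)).

(* \Gamma(S^w): psi (q h) = kappaw(h)^-1 psi q, and psi is smooth. *)
Definition spinor_section (w : R) (psi : Q -> spinor R n) : Prop :=
  (forall q h, CSpin h -> kappaw gam w h *m psi (act q h) = psi q) /\
  (forall U s, sec U s -> smooth_spinor U (fun x => psi (s x))).

(* A spinor field given by its components in all gauges s, and the components
   of a section of S^w. *)
Definition spinor_field := (M -> Q) -> M -> spinor R n.
Definition components (psi : Q -> spinor R n) : spinor_field :=
  fun s x => psi (s x).

(* The conformal frame field under the gauge s. *)
Definition cov_fr (s : M -> Q) : M -> frame M := fun x => cov (s x).

(* \nabla^S on S^w. *)
Definition covS (w : R) (X : vfield M) (s : M -> Q) (f : M -> spinor R n) :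
    M -> spinor R n :=
  fun x => der_spinor (X x) f + dkappaw gam w (W (cov_fr s) x (X x)) *m f x.

Definition Dirac (w : R) (psi : spinor_field) : spinor_field := fun s x =>
  \sum_i gam i *m covS w (fr_vf (cov_fr s) i) s (psi s) x.

(* (\nabla_X \Phi)(Z) = \nabla_X (\Phi(Z)) - \Phi(\nabla_X Z) on T^* \otimes S^w,
   for Z with components z. *)
Definition covTS (w : R) (X : vfield M) (s : M -> Q)
    (Phi : vfield M -> M -> spinor R n) (z : M -> 'cV[R]_n) :
    M -> spinor R n :=
  fun x => covS w X s (Phi (vf_of (cov_fr s) z)) x
           - Phi (vf_of (cov_fr s) (covT W (cov_fr s) X z)) x.

Definition spinor_laplacian (w : R) (psi : spinor_field) : spinor_field :=
  fun s x => - \sum_i covTS w (fr_vf (cov_fr s) i) s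
                  (fun Y => covS w Y s (psi s)) (@bas R n M i) x.

Definition scalS (psi : spinor_field) : spinor_field := fun s x =>
  (scal W (cov_fr s) x)%:C *: psi s x.

Definition faradayS (g : metric M) (psi : spinor_field) : spinor_field :=
  fun s x => \sum_i \sum_j
    (faraday W g (cov_fr s) (fr_vf (cov_fr s) i) (fr_vf (cov_fr s) j) x)%:C
      *: (gam i *m (gam j *m psi s x)).

End CSpinStructure.

(* Main.v *)
Require Import Defs.
From mathcomp Require Import all_boot all_order all_algebra.
From mathcomp Require Import all_classical all_reals all_analysis.
From mathcomp Require Import complex ring lra.

Set Implicit Arguments.
Unset Strict Implicit.
Unset Printing Implicit Defensive.
Import Order.TTheory GRing.Theory Num.Theory.
Import numFieldNormedType.Exports.
Local Open Scope classical_set_scope.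
Local Open Scope ring_scope.
Local Open Scope complex_scope.

(** In a local conformal frame e_1, .., e_n write g_i for Clifford multiplication
    by e_i.  The argument has four ingredients.

    - Clifford multiplication intertwines the actions of co(n) on S^w and on
      S^(w-1) up to the action on covectors ([dkappaw_gam]).  Hence g_j commutes
      with the covariant derivative, and D^2 psi is the sum of the
      g_i g_j X_ij, where X is the second covariant derivative of psi
      ([dirac_square_hessian]).

    - The Clifford relation splits this sum into minus the trace of X, which
      is the spinor Laplacian, and half the sum of the g_i g_j (X_ij - X_ji)
      ([clifford_contract]).  As there is no torsion, X_ij - X_ji is the
      action on psi of the curvature Om_ij in co(n) ([hessian_commutator]).

    - Om_ij has a scalar part F_ij, which acts on S^w as w F_ij and contributes
      (w/2) F psi, and a part in so(n), which acts through the spin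
      representation.  To contract the latter one needs the first Bianchi
      identity ([first_bianchi]), which here is the Jacobi identity for the
      frame fields read through the vanishing of the torsion.  It reduces
      the product of four Clifford generators to a contraction with the Ricci
      tensor ([clifford_triple]).  The Ricci tensor of a Weyl structure is
      not symmetric: its trace gives R/4, and its skew part, a multiple of F,
      combines with the failure of Om_ij to be skew-symmetric to give
      (n-2)/4 F ([clifford_curvature]).

    - F, defined as the differential of theta for a metric g of the class, is
      the trace part of the curvature because theta and the trace of the
      connection form differ by the logarithmic derivative of lg
      ([faraday_curv_trace]).

    All algebra is done at one point ([weitzenboeck_at_point]); what remains
    is to differentiate products of smooth functions, matrices and spinors. *)

(** * Smooth functions on open sets of R^n *)

Section SmoothFunctionsOnRn.
Variables (R : realType) (n : nat).
Implicit Types (O : set 'rV[R]_n) (f g : 'rV[R]_n -> R).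

Lemma Ck_continuous k O f : Ck k O f -> forall y, O y -> {for y, continuous f}.
Proof. by case: k => [|k] []. Qed.

Lemma Ck_sub k O O' f : O' `<=` O -> Ck k O f -> Ck k O' f.
Proof.
move=> sO; elim: k f => [|k IH] f /= [fc fd]; (split; first by move=> y /sO /fc).
  by [].
move=> i; have [fd1 fd2] := fd i; split; [by move=> y /sO /fd1|exact: IH].
Qed.

Lemma Ck_congr k O f g : open O -> (forall y, O y -> f y = g y) ->
  Ck k O f -> Ck k O g.
Proof.
move=> Oo.
have nearO f' g' : (forall y, O y -> f' y = g' y) ->
    forall y : 'rV[R]_n, O y -> \forall z \near y, f' z = g' z.
  move=> fg y Oy; apply: filterS (open_nbhs_nbhs (conj Oo Oy)).
  exact: fg.
elim: k f g => [|k IH] f g fg /= [fc fd]; (split; first by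
  move=> y Oy; rewrite /prop_for /continuous_at -(fg y Oy);
  apply: cvg_trans (fc y Oy); exact: near_eq_cvg (nearO _ _ fg y Oy)).
  by [].
move=> i; have [fd1 fd2] := fd i; split.
  by move=> y Oy; apply: near_eq_derivable (fd1 y Oy); exact: nearO.
by apply: IH fd2 => y Oy; rewrite /partial; apply: near_eq_derive; exact: nearO.
Qed.

Lemma Ck_pred k O f : Ck k.+1 O f -> Ck k O f.
Proof.
elim: k f => [|k IH] f [fc fd]; (split; first exact: fc).
  by [].
by move=> i; have [fd1 fd2] := fd i; split => //; exact: IH.
Qed.

Lemma Ck_cst k O a : Ck k O (fun _ => a).
Proof.
elim: k a => [|k IH] a /=; (split; first by move=> y _; exact: cst_continuous).
  by [].
move=> i; split=> [y _|]; first exact: derivable_cst.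
rewrite (_ : partial i _ = fun _ => 0) //.
by apply/funext => y; exact: derive_cst.
Qed.

Lemma Ck_add k O f g : open O -> Ck k O f -> Ck k O g ->
  Ck k O (fun y => f y + g y).
Proof.
move=> Oo; elim: k f g => [|k IH] f g [fc fd] [gc gd];
  (split; first by move=> y Oy; exact: cvgD (fc y Oy) (gc y Oy)).
  by [].
move=> i; have [fd1 fd2] := fd i; have [gd1 gd2] := gd i; split.
  by move=> y Oy; exact: derivableD (fd1 y Oy) (gd1 y Oy).
apply: Ck_congr Oo _ (IH _ _ fd2 gd2) => y Oy; apply/esym.
exact: deriveD (fd1 y Oy) (gd1 y Oy).
Qed.

Lemma Ck_mul k O f g : open O -> Ck k O f -> Ck k O g ->
  Ck k O (fun y => f y * g y).
Proof.
move=> Oo; elim: k f g => [|k IH] f g fk gk;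
  (split; first by move=> y Oy;
   exact: cvgM (Ck_continuous fk Oy) (Ck_continuous gk Oy)).
  by [].
move=> i; have [fd1 fd2] := fk.2 i; have [gd1 gd2] := gk.2 i; split.
  by move=> y Oy; exact: derivableM (fd1 y Oy) (gd1 y Oy).
have := Ck_add Oo (IH _ _ (Ck_pred fk) gd2) (IH _ _ (Ck_pred gk) fd2).
apply: Ck_congr Oo _ => y Oy; apply/esym.
exact: deriveM (fd1 y Oy) (gd1 y Oy).
Qed.

(** A partial derivative only sees the restriction of [f] to a line, so the
    one-variable chain rule applies although [f] is not known to be
    differentiable. *)
Lemma is_derive_powR_comp f (a : R) (y v : 'rV[R]_n) : 0 < f y ->
  derivable (f : 'rV[R]_n -> R^o) y v ->
  is_derive y v ((fun z => f z `^ a) : 'rV[R]_n -> R^o)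
    (a * f y `^ (a - 1) * 'D_v (f : 'rV[R]_n -> R^o) y).
Proof.
move=> fy0 fd.
pose h : R -> R := fun t => f (t *: v + y).
have h0 : h 0 = f y by rewrite /h scale0r add0r.
have hd : derivable (h : R -> R^o) 0 1.
  exact: (derivable1P (f : 'rV[R]_n -> R^o) y v).1 fd.
have E (g : 'rV[R]_n -> R) :
    'D_v (g : 'rV[R]_n -> R^o) y = 'D_1 ((fun t => g (t *: v + y)) : R -> R^o) 0.
  rewrite /derive; set d1 := fun t => _; set d2 := fun t => _.
  suff -> : d1 = d2 by [].
  by apply/funext => t; rewrite /d1 /d2 /= scale0r add0r addr0 [t%:A]mulr1.
have hD : is_derive (0:R) 1 (h : R -> R^o) ('D_v (f : _ -> R^o) y).
  by rewrite E; exact: derivableP.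
have pD : is_derive (h 0) 1 (@powR R ^~ a) (a * f y `^ (a - 1)).
  by rewrite h0; exact: is_derive1_powR.
have [cd cD] := is_derive1_comp (f := @powR R ^~ a) (g := h) pD hD.
split; last by rewrite E -cD.
exact: (derivable1P ((fun z => f z `^ a) : 'rV[R]_n -> R^o) y v).2 cd.
Qed.

(** The exponent is generalised in the induction: differentiating the power a of
    [f] produces the power a - 1, so that all powers have to be treated together. *)
Lemma Ck_powR k O f (a : R) : open O -> (forall y, O y -> 0 < f y) ->
  Ck k O f -> Ck k O (fun y => f y `^ a).
Proof.
move=> Oo f0; elim: k f a f0 => [|k IH] f a f0 fk.
  split=> // y Oy; have [pd _] := is_derive1_powR a (f0 y Oy).
  have pc : {for f y, continuous (@powR R ^~ a)}.
    by apply: differentiable_continuous; exact/derivable1_diffP.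
  exact: (@continuous_comp _ _ _ f (@powR R ^~ a) y (Ck_continuous fk Oy) pc).
have D i y : O y -> is_derive y (delta_mx 0 i : 'rV[R]_n)
    ((fun z => f z `^ a) : 'rV[R]_n -> R^o) (a * f y `^ (a - 1) * partial i f y).
  by move=> Oy; apply: is_derive_powR_comp; [exact: f0|have [+ _] := fk.2 i; exact].
split; first by exact: (Ck_continuous (IH f a f0 (Ck_pred fk))).
move=> i; split=> [y /(D i) []//|].
have := Ck_mul Oo (Ck_mul Oo (Ck_cst k O a) (IH f (a - 1) f0 (Ck_pred fk)))
  (fk.2 i).2.
by apply: Ck_congr Oo _ => y /(D i) [_ ?]; apply/esym.
Qed.

End SmoothFunctionsOnRn.

(** * Smooth functions and tangent vectors on a manifold *)

Section SmoothFunctions.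
Variables (R : realType) (n : nat) (M : oriented_manifold R n).
Implicit Types (U V : set M) (f g : M -> R).

Lemma open_near U x (P : M -> Prop) : open U -> U x ->
  (forall y, U y -> P y) -> \forall y \near x, P y.
Proof. by move=> Uo Ux UP; apply: filterS (open_nbhs_nbhs (conj Uo Ux)). Qed.

(** Differentiability on a subset of R^n is only well behaved when the subset is
    open, and this is where the charts provide such subsets. *)
Lemma open_chart_image V (phi : chart R n M) : atlas phi -> open V ->
  open (cmap phi @` (V `&` cdom phi)).
Proof.
move=> /atlas_chart [_ io cK _ ic] Vo; rewrite openE => y [z [Vz cz] <-].
have Oy : (cmap phi @` cdom phi) (cmap phi z) by exists z.
have VN : nbhs (cinv phi (cmap phi z)) V by rewrite cK //; exact: open_nbhs_nbhs.
apply: filterS2 (open_nbhs_nbhs (conj io Oy)) (ic _ Oy _ VN) => _ [z' cz' <-] /=.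
by rewrite cK // => Vz'; exists z'.
Qed.

Lemma smooth_on_sub V U f : V `<=` U -> smooth_on U f -> smooth_on V f.
Proof.
by move=> VU fs phi aphi k; apply: Ck_sub (fs phi aphi k) => _ [z [/VU ? ?] <-]; exists z.
Qed.

Lemma smooth_on_congr V f g : open V -> (forall x, V x -> f x = g x) ->
  smooth_on V f -> smooth_on V g.
Proof.
move=> Vo fg fs phi aphi k; apply: Ck_congr (fs phi aphi k).
  exact: open_chart_image.
move=> _ [z [Vz cz] <-] /=; apply: fg.
by have [_ _ -> //] := atlas_chart aphi.
Qed.

Lemma smooth_on_cst V (a : R) : smooth_on V (fun _ : M => a).
Proof. by move=> phi aphi k; exact: Ck_cst. Qed.

Lemma smooth_on_add V f g : open V -> smooth_on V f -> smooth_on V g ->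
  smooth_on V (fun x => f x + g x).
Proof.
move=> Vo fs gs phi aphi k; apply: Ck_add (fs phi aphi k) (gs phi aphi k).
exact: open_chart_image.
Qed.

Lemma smooth_on_mul V f g : open V -> smooth_on V f -> smooth_on V g ->
  smooth_on V (fun x => f x * g x).
Proof.
move=> Vo fs gs phi aphi k; apply: Ck_mul (fs phi aphi k) (gs phi aphi k).
exact: open_chart_image.
Qed.

Lemma smooth_on_powR V f (a : R) : open V -> (forall x, V x -> 0 < f x) ->
  smooth_on V f -> smooth_on V (fun x => f x `^ a).
Proof.
move=> Vo f0 fs phi aphi k; apply: Ck_powR (fs phi aphi k).
  exact: open_chart_image.
move=> _ [z [Vz cz] <-] /=; have [_ _ -> // _ _] := atlas_chart aphi.
exact: f0.
Qed.

Lemma smooth_on_opp V f : open V -> smooth_on V f -> smooth_on V (fun x => - f x).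
Proof.
move=> Vo fs; apply: smooth_on_congr (smooth_on_mul Vo (smooth_on_cst V (-1)) fs) => //.
by move=> x _; rewrite mulN1r.
Qed.

Lemma smooth_on_sub_fun V f g : open V -> smooth_on V f -> smooth_on V g ->
  smooth_on V (fun x => f x - g x).
Proof. by move=> Vo fs gs; apply: smooth_on_add => //; exact: smooth_on_opp. Qed.

Lemma smooth_on_sum (I : Type) (r : seq I) V (F : I -> M -> R) : open V ->
  (forall i, smooth_on V (F i)) -> smooth_on V (fun x => \sum_(i <- r) F i x).
Proof.
move=> Vo Fs; elim: r => [|i r IH].
  by apply: smooth_on_congr (smooth_on_cst V 0) => // x _; rewrite big_nil.
apply: smooth_on_congr (smooth_on_add Vo (Fs i) IH) => // x _.
by rewrite big_cons.
Qed.

Lemma smooth_on_exp V f k : open V -> smooth_on V f ->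
  smooth_on V (fun x => f x ^+ k).
Proof.
move=> Vo fs; elim: k => [|k IH]; first exact: smooth_on_cst.
by apply: smooth_on_congr (smooth_on_mul Vo fs IH) => // x _; rewrite exprS.
Qed.

Lemma smooth_on_near V f x : open V -> V x -> smooth_on V f -> smooth_near x f.
Proof. by move=> Vo Vx fs; exists V. Qed.

End SmoothFunctions.

Section TangentVectors.
Variables (R : realType) (n : nat) (M : oriented_manifold R n).
Variables (U : set M) (x : M) (v : tvec M).
Hypotheses (Uo : open U) (Ux : U x) (vx : tangent x v).
Implicit Types f g : M -> R.

Let near_x f : smooth_on U f -> smooth_near x f := smooth_on_near Uo Ux.

Lemma tangent_congr f g : smooth_on U f -> (forall y, U y -> f y = g y) ->
  v f = v g.
Proof. by move=> fs fg; apply: (tangent_germ vx (near_x fs)); exact: open_near Ux fg. Qed.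

Lemma tangent_cst (a : R) : v (fun _ => a) = 0.
Proof.
have cs b : smooth_near x (fun _ : M => b) by apply: near_x; exact: smooth_on_cst.
have v1 : v (fun _ => 1) = 0.
  have := tangent_leibniz vx (cs 1) (cs 1).
  have -> : (fun _ : M => 1 * 1 : R) = (fun _ => 1) by rewrite mulr1.
  by rewrite mulr1 mul1r -{1}[v _]addr0 => /addrI.
have v0 : v (fun _ => 0) = 0.
  have := tangent_lin vx (-1) (cs 1) (cs 1).
  have -> : (fun _ : M => -1 * 1 + 1 : R) = (fun _ => 0) by rewrite mulN1r addNr.
  by rewrite v1 mulr0 addr0.
have := tangent_lin vx a (cs 1) (cs 0).
have -> : (fun _ : M => a * 1 + 0) = (fun _ => a) by rewrite mulr1 addr0.
by rewrite v1 v0 mulr0 addr0.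
Qed.

Lemma tangent_add f g : smooth_on U f -> smooth_on U g ->
  v (fun y => f y + g y) = v f + v g.
Proof.
move=> fs gs; rewrite -[v f]mul1r -(tangent_lin vx 1 (near_x fs) (near_x gs)).
by congr v; apply/funext => y; rewrite mul1r.
Qed.

Lemma tangent_mul f g : smooth_on U f -> smooth_on U g ->
  v (fun y => f y * g y) = v f * g x + f x * v g.
Proof. by move=> fs gs; exact: (tangent_leibniz vx (near_x fs) (near_x gs)). Qed.

Lemma tangent_scale (a : R) f : smooth_on U f -> v (fun y => a * f y) = a * v f.
Proof.
move=> fs; rewrite tangent_mul //; last exact: smooth_on_cst.
by rewrite tangent_cst mul0r add0r.
Qed.

Lemma tangent_opp f : smooth_on U f -> v (fun y => - f y) = - v f.
Proof.
move=> fs; rewrite -mulN1r -(tangent_scale _ fs).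
by congr v; apply/funext => y; rewrite mulN1r.
Qed.

Lemma tangent_sub f g : smooth_on U f -> smooth_on U g ->
  v (fun y => f y - g y) = v f - v g.
Proof.
move=> fs gs; rewrite (tangent_add fs (smooth_on_opp Uo gs)).
by rewrite tangent_opp.
Qed.

Lemma tangent_sum (I : Type) (r : seq I) (F : I -> M -> R) :
  (forall i, smooth_on U (F i)) ->
  v (fun y => \sum_(i <- r) F i y) = \sum_(i <- r) v (F i).
Proof.
move=> Fs; elim: r => [|i r IH].
  rewrite big_nil -[RHS](tangent_cst 0); congr v; apply/funext => y.
  by rewrite big_nil.
rewrite big_cons -IH -(tangent_add (Fs i) (smooth_on_sum r Uo Fs)).
by congr v; apply/funext => y; rewrite big_cons.
Qed.

End TangentVectors.

Section TangentCombinations.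
Variables (R : realType) (n : nat) (M : oriented_manifold R n) (x : M).
Implicit Types u v : tvec M.

Lemma tangent_comb (a : R) u v : tangent x u -> tangent x v ->
  tangent x (fun f => a * u f + v f).
Proof.
move=> ux vx; split.
- by move=> f g fs fg; rewrite (tangent_germ ux fs fg) (tangent_germ vx fs fg).
- by move=> b f g fs gs; rewrite (tangent_lin ux b fs gs) (tangent_lin vx b fs gs); ring.
- move=> f g fs gs; rewrite (tangent_leibniz ux fs gs) (tangent_leibniz vx fs gs).
  by ring.
- by move=> f nf; rewrite (tangent_out ux nf) (tangent_out vx nf) mulr0 addr0.
Qed.

Lemma tangent_zero : tangent x (fun _ : M -> R => 0).
Proof.
by split=> // [a f g _ _|f g _ _]; rewrite ?mulr0 ?mul0r addr0.
Qed.

Lemma tangent_comb_sum (I : Type) (r : seq I) (b : I -> R) (u : I -> tvec M) :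
  (forall i, tangent x (u i)) -> tangent x (fun f => \sum_(i <- r) b i * u i f).
Proof.
move=> ux; elim: r => [|i r IH].
  rewrite (_ : (fun f => _) = fun _ : M -> R => 0); first exact: tangent_zero.
  by apply/funext => f; rewrite big_nil.
rewrite (_ : (fun f => _) =
  fun f => b i * u i f + \sum_(j <- r) b j * u j f); first exact: tangent_comb.
by apply/funext => f; rewrite big_cons.
Qed.

(** Linearity of a map defined on the tangent vectors at [x], in the form used
    for metrics and connection forms, extends to finite combinations. *)
Lemma lin_comb_sum (V : lmodType R) (F : tvec M -> V)
    (Flin : forall a u v, tangent x u -> tangent x v ->
       F (fun f => a * u f + v f) = a *: F u + F v)
    (I : Type) (r : seq I) (b : I -> R) (u : I -> tvec M) :
  (forall i, tangent x (u i)) ->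
  F (fun f => \sum_(i <- r) b i * u i f) = \sum_(i <- r) b i *: F (u i).
Proof.
move=> ux; elim: r => [|i r IH].
  have := Flin (-1) _ _ tangent_zero tangent_zero.
  rewrite scaleN1r addNr big_nil => <-; congr F.
  by apply/funext => f; rewrite big_nil mulr0 addr0.
rewrite big_cons -IH -Flin //; last exact: tangent_comb_sum.
by congr F; apply/funext => f; rewrite big_cons.
Qed.

End TangentCombinations.

(** * Frames, torsion and curvature *)

(** The Lie algebra so(n) + R is closed under commutators, and these have no
    scalar part. *)
Lemma co_lie_commutator (R : realType) (n : nat) (X Y : 'M[R]_n) (a b : R) :
  X + X^T = a%:M -> Y + Y^T = b%:M ->
  (X *m Y - Y *m X)^T = - (X *m Y - Y *m X).
Proof.
move=> hX hY; have XT : X^T = a%:M - X by rewrite -hX addrC addKr.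
have YT : Y^T = b%:M - Y by rewrite -hY addrC addKr.
rewrite linearB /= !trmx_mul XT YT !mulmxBl !mulmxBr !mul_scalar_mx !mul_mx_scalar.
move: (X *m Y) (Y *m X) => P Q; apply/matrixP => i j; rewrite !mxE; ring.
Qed.

Lemma co_lieE (R : realType) (n : nat) (n_gt0 : (0 < n)%N) (B : 'M[R]_n) : co_lie B ->
  forall k l, B k l + B l k = 2 * co_tr B * (k == l)%:R.
Proof.
move=> [a eB] k l; have n0 : n%:R != 0 :> R by rewrite pnatr_eq0 -lt0n.
have := congr1 mxtrace eB.
rewrite linearD /= mxtrace_tr mxtrace_scalar => trB.
have aE : a = 2 * co_tr B.
  by rewrite /co_tr mulrA mulr_natl mulr2n trB -[a *+ n]mulr_natr mulfK.
by have /matrixP/(_ k l) := eB; rewrite !mxE -aE => ->; rewrite mulr_natr.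
Qed.

Lemma co_so_anti (R : realType) (n : nat) (n_gt0 : (0 < n)%N) (B : 'M[R]_n) :
  co_lie B -> forall k l, co_so B k l = - co_so B l k.
Proof.
move=> hB k l; have := co_lieE n_gt0 hB k l; rewrite /co_so !mxE [l == k]eq_sym.
case: eqVneq => _; rewrite ?mulr1n ?mulr0n; lra.
Qed.

Section WeylFrame.
Variables (R : realType) (n : nat) (M : oriented_manifold R n).
Variables (c : set (metric M)) (W : weyl_structure c).
Variables (U : set M) (e : M -> frame M).
Hypothesis eU : frame_field c U e.

Let Uo : open U. Proof. by case: eU. Qed.

Definition frame_form (i : 'I_n) (x : M) : 'M[R]_n := W e x (e x i).

Definition frame_trace (i : 'I_n) (x : M) : R := co_tr (frame_form i x).

(** The structure functions of the frame, computed from the connection. *)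
Definition bracket_coef (l i j : 'I_n) (x : M) : R :=
  frame_form i x l j - frame_form j x l i.

(** Cartan's structure equation, evaluated on two frame vectors: the term with
    [bracket_coef] is the connection form on their bracket. *)
Definition curv_form (i j : 'I_n) (x : M) : 'M[R]_n :=
  der_mx (e x i) (frame_form j) - der_mx (e x j) (frame_form i)
  + (frame_form i x *m frame_form j x - frame_form j x *m frame_form i x)
  - \sum_l bracket_coef l i j x *: frame_form l x.

(** The same expression for the trace part, that is the curvature of L^1. *)
Definition curv_trace (i j : 'I_n) (x : M) : R :=
  e x i (frame_trace j) - e x j (frame_trace i)
  - \sum_l bracket_coef l i j x * frame_trace l x.

Lemma curv_form_entry i j x k l : curv_form i j x k l =
  e x i (fun y => frame_form j y k l) - e x j (fun y => frame_form i y k l)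
  + (frame_form i x *m frame_form j x - frame_form j x *m frame_form i x) k l
  - \sum_m bracket_coef m i j x * frame_form m x k l.
Proof.
have E (P Q K S : 'M[R]_n) : (P - Q + K - S) k l = P k l - Q k l + K k l - S k l.
  by rewrite !mxE.
rewrite /curv_form E summxE /der_mx [X in X - _ + _ - _]mxE [X in _ - X + _ - _]mxE.
by congr (_ - _); apply: eq_bigr => m _; rewrite mxE.
Qed.

Lemma frame_tangent x i : U x -> tangent x (e x i).
Proof. by case: eU => _ + _ Ux => /(_ x Ux) []. Qed.

Lemma smooth_frame_der V i f : open V -> V `<=` U -> smooth_on V f ->
  smooth_on V (fun x => e x i f).
Proof. by case: eU => _ _ /(_ i) [_ h] Vo VU fs; exact: h. Qed.

Lemma smooth_frame_form i k l : smooth_on U (fun x => frame_form i x k l).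
Proof. by case: eU => _ _ es; exact: (cform_smooth W eU (es i)). Qed.

Lemma smooth_frame_trace i : smooth_on U (frame_trace i).
Proof.
apply: smooth_on_mul => //; last exact: smooth_on_cst.
by apply: smooth_on_sum => // k; exact: smooth_frame_form.
Qed.

Lemma smooth_bracket_coef l i j : smooth_on U (bracket_coef l i j).
Proof. by apply: smooth_on_sub_fun => //; exact: smooth_frame_form. Qed.

Lemma vf_of_bas i : vf_of e (@bas R n M i) = fr_vf e i.
Proof.
apply/funext => x; apply/funext => f; rewrite /vf_of /bas /fr_vf (bigD1 i) //=.
rewrite mxE !eqxx mul1r big1 ?addr0 // => k /negbTE ki.
by rewrite mxE ki mul0r.
Qed.

Lemma mulmx_bas (A : 'M[R]_n) k x : A *m @bas R n M k x = col k A.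
Proof. by rewrite /bas -colE. Qed.

Lemma covT_bas x X k : U x -> tangent x (X x) ->
  covT W e X (@bas R n M k) x = col k (W e x (X x)).
Proof.
move=> Ux Xx; rewrite /covT mulmx_bas; apply/colP => l.
by rewrite 2!mxE (tangent_cst Uo Ux Xx) add0r.
Qed.

Lemma conn_comb x (b : 'I_n -> R) : U x ->
  W e x (fun f => \sum_l b l * e x l f) = \sum_l b l *: frame_form l x.
Proof.
move=> Ux; apply: (@lin_comb_sum _ _ _ x) => [a u v ux vx|l].
  exact: cform_lin eU Ux ux vx.
exact: frame_tangent.
Qed.

Lemma smooth_bas i : smooth_mx U (@bas R n M i).
Proof. by move=> k l; exact: smooth_on_cst. Qed.

(** Vanishing torsion, tested on the frame vectors themselves. *)
Lemma bracket_frame x i j : U x -> bracket (fr_vf e i) (fr_vf e j) x =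
  fun f => \sum_l bracket_coef l i j x * e x l f.
Proof.
move=> Ux; have := weyl_torsion W eU (smooth_bas i) (smooth_bas j) Ux.
rewrite !vf_of_bas => <-; apply/funext => f.
rewrite /vf_of -sumrB; apply: eq_bigr => l _.
by rewrite !covT_bas //; [rewrite ![col _ _ _ _]mxE -mulrBl|exact: frame_tangent..].
Qed.

Lemma bracket_tangent x i j : U x -> tangent x (bracket (fr_vf e i) (fr_vf e j) x).
Proof.
by move=> Ux; rewrite bracket_frame //; apply: tangent_comb_sum => l; exact: frame_tangent.
Qed.

Lemma frame_commutator V x i j f : open V -> V `<=` U -> V x -> smooth_on V f ->
  e x i (fun y => e y j f) - e x j (fun y => e y i f) =
  \sum_l bracket_coef l i j x * e x l f.
Proof.
move=> Vo VU Vx fs; have /(congr1 (@^~ f)) := bracket_frame i j (VU _ Vx).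
move=> <-; rewrite /bracket; case: asboolP => // -[].
exact: smooth_on_near Vo Vx fs.
Qed.

Lemma covT_covT_bas x i j k : U x ->
  covT W e (fr_vf e i) (covT W e (fr_vf e j) (@bas R n M k)) x =
  col k (der_mx (e x i) (frame_form j) + frame_form i x *m frame_form j x).
Proof.
move=> Ux; have ex m y : U y -> tangent y (e y m) := @frame_tangent y m.
rewrite {1}/covT (covT_bas _ Ux (ex j x Ux)) -/(frame_form i x) -/(frame_form j x).
rewrite linearD /= [col k (_ *m _)]colE -mulmxA -colE; congr (_ + _).
apply/colP => r; rewrite !mxE.
apply/esym/(tangent_congr Uo Ux (ex i x Ux)); first exact: smooth_frame_form.
by move=> y Uy; rewrite covT_bas ?mxE //; exact: ex.
Qed.

Lemma curvT_bas x i j k : U x ->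
  curvT W e (fr_vf e i) (fr_vf e j) (@bas R n M k) x = col k (curv_form i j x).
Proof.
move=> Ux; rewrite /curvT !covT_covT_bas // covT_bas //; last exact: bracket_tangent.
rewrite bracket_frame // conn_comb // -!linearB /=; congr (col k (_ - _)).
by rewrite opprD addrACA.
Qed.

Lemma Riem_curv_form x i j k l : U x ->
  Riem W e i j k l x = curv_form i j x l k.
Proof.
move=> Ux; rewrite /Riem /cprod curvT_bas // (bigD1 l) //= big1 => [|m /negbTE ml].
  by rewrite addr0 mxE [bas _ _ _ _]mxE !eqxx mulr1.
by rewrite [bas _ _ _ _]mxE ml mulr0.
Qed.

(** ** The first Bianchi identity *)

Hypotheses (n_gt0 : (0 < n)%N) (hc : conformal_class c).
Variables (g : metric M).
Hypothesis hg : c g.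

Lemma class_riemannian : riemannian g.
Proof. by have [g0 _ /(_ g) [/(_ hg) []]] := hc. Qed.

(** The frame is orthogonal for a metric of the class, and a tangent vector that
    annihilates smooth germs is zero, since it vanishes elsewhere by convention. *)
Lemma frame_free x (b : 'I_n -> R) : U x ->
  (forall V f, open V -> V `<=` U -> V x -> smooth_on V f ->
     \sum_l b l * e x l f = 0) ->
  forall l, b l = 0.
Proof.
move=> Ux b0 l; have ex m : tangent x (e x m) := frame_tangent m Ux.
have v0 : (fun f => \sum_l b l * e x l f) = fun _ => 0.
  apply/funext => f; have [[V [Vo Vx fs]]|nf] := pselect (smooth_near x f).
    apply: (b0 (V `&` U)) => //; first exact: openI.
    by apply: smooth_on_sub fs; exact: subIsetl.
  by rewrite big1 // => m _; rewrite (tangent_out (ex m) nf) mulr0.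
have gl := riem_lin class_riemannian.
pose G (v : tvec M) : R^o := g x v (e x l).
have Glin a u v : tangent x u -> tangent x v ->
    G (fun f => a * u f + v f) = a *: G u + G v by move=> ux vx; exact: gl.
have := lin_comb_sum Glin (index_enum 'I_n) b ex.
have := lin_comb_sum Glin [::] b ex.
rewrite big_nil (_ : (fun f => _) = fun _ => 0); last first.
  by apply/funext => f; rewrite big_nil.
rewrite v0 => ->; have [_ /(_ x Ux) [_ _ /(_ g hg) [t t0 gt]] _] := eU.
rewrite (bigD1 l) //= big1 => [|m ml]; last by rewrite /G gt (negbTE ml) scaler0.
rewrite addr0 /G gt eqxx => /esym/eqP; rewrite mulf_eq0 expf_eq0 /= (gt_eqF t0).
by rewrite orbF => /eqP.
Qed.

(** One of the three terms of the Jacobi identity, with both brackets expanded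
    in the frame. *)
Lemma jacobi_term V x i j k f : open V -> V `<=` U -> V x -> smooth_on V f ->
  \sum_m (e x k (bracket_coef m i j)
          - \sum_l bracket_coef l i j x * bracket_coef m l k x) * e x m f =
  e x k (fun y => e y i (fun z => e z j f)) - e x k (fun y => e y j (fun z => e z i f))
  - (e x i (fun y => e y j (fun z => e z k f)) - e x j (fun y => e y i (fun z => e z k f))).
Proof.
move=> Vo VU Vx fs; have Ux := VU x Vx; have ex m := frame_tangent m Ux.
have fd m : smooth_on V (fun y => e y m f) by exact: smooth_frame_der.
have fdd p q : smooth_on V (fun y => e y p (fun z => e z q f)).
  by apply: smooth_frame_der.
have cs l p q : smooth_on V (bracket_coef l p q).
  by apply: smooth_on_sub VU _; exact: smooth_bracket_coef.
rewrite -(tangent_sub Vo Vx (ex k) (fdd i j) (fdd j i)).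
rewrite -(tangent_congr (f := fun y => \sum_l bracket_coef l i j y * e y l f) Vo Vx (ex k));
  first last.
- by move=> y Vy; rewrite (frame_commutator i j Vo VU Vy fs).
- by apply: smooth_on_sum => // l; exact: smooth_on_mul.
rewrite (tangent_sum Vo Vx (ex k)); last by move=> l; exact: smooth_on_mul.
rewrite (frame_commutator i j Vo VU Vx (fd k)) -sumrB.
under [RHS]eq_bigr => l _ do
  rewrite (tangent_mul Vo Vx (ex k) (cs l i j) (fd l)) -addrA -mulrBr
    -opprB (frame_commutator l k Vo VU Vx fs) mulrN mulr_sumr.
rewrite sumrB exchange_big -sumrB; apply: eq_bigr => m _ /=.
rewrite mulrBl mulr_suml; congr (_ - _); apply: eq_bigr => l _.
by rewrite mulrA.
Qed.

(** The third derivatives of a test function cancel in the cyclic sum of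
    [jacobi_term], and linear independence of the frame removes the test
    function. *)
Lemma bracket_jacobi x i j k m : U x ->
  let S i j k := e x k (bracket_coef m i j)
     - \sum_l bracket_coef l i j x * bracket_coef m l k x in
  S i j k + S j k i + S k i j = 0.
Proof.
move=> Ux; pose T m i j k := e x k (bracket_coef m i j)
     - \sum_l bracket_coef l i j x * bracket_coef m l k x.
move: m; apply: (@frame_free x (fun m => T m i j k + T m j k i + T m k i j)) => //.
move=> V f Vo VU Vx fs.
have hT p q r := jacobi_term p q r Vo VU Vx fs.
transitivity (\sum_l T l i j k * e x l f + \sum_l T l j k i * e x l f
              + \sum_l T l k i j * e x l f).
  by rewrite -!big_split; apply: eq_bigr => l _ /=; rewrite !mulrDl.
by rewrite /T !hT; ring.
Qed.

(** The structure functions are the antisymmetrised connection coefficients, so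
    that the Jacobi identity is a relation between these and their first
    derivatives; it is the cyclic sum of the structure equation. *)
Lemma first_bianchi x i j k m : U x ->
  curv_form i j x m k + curv_form j k x m i + curv_form k i x m j = 0.
Proof.
move=> Ux; have ex l := frame_tangent l Ux.
have J := bracket_jacobi i j k m Ux.
have Dc p q r : e x r (bracket_coef m p q) =
    e x r (fun y => frame_form p y m q) - e x r (fun y => frame_form q y m p).
  by rewrite (tangent_sub Uo Ux (ex r)) //; exact: smooth_frame_form.
have cE p q r : curv_form p q x m r =
    e x p (fun y => frame_form q y m r) - e x q (fun y => frame_form p y m r)
    + \sum_l (frame_form p x m l * frame_form q x l r
              - frame_form q x m l * frame_form p x l r
              - bracket_coef l p q x * frame_form l x m r).
  by rewrite curv_form_entry !mxE !sumrB !addrA.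
rewrite /= !Dc in J; rewrite !cE.
set s1 := \sum_l _ in J; set s2 := \sum_l _ in J; set s3 := \sum_l _ in J.
set r1 := \sum_l _; set r2 := \sum_l _; set r3 := \sum_l _.
have K : s1 + s2 + s3 + r1 + r2 + r3 = 0.
  rewrite /s1 /s2 /s3 /r1 /r2 /r3 -!big_split big1 // => l _ /=.
  by rewrite /bracket_coef; ring.
by clearbody s1 s2 s3 r1 r2 r3; lra.
Qed.

(** ** The trace part of the curvature *)

Lemma frame_form_anti i x k l : U x ->
  frame_form i x k l + frame_form i x l k = 2 * frame_trace i x * (k == l)%:R.
Proof.
move=> Ux; exact: (co_lieE n_gt0 (cform_co W eU Ux (frame_tangent i Ux))).
Qed.

Lemma curv_form_sym i j x k l : U x ->
  curv_form i j x k l + curv_form i j x l k = 2 * curv_trace i j x * (k == l)%:R.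
Proof.
move=> Ux; have ex m := frame_tangent m Ux.
have D p q : e x p (fun y => frame_form q y k l) + e x p (fun y => frame_form q y l k)
    = 2 * e x p (frame_trace q) * (k == l)%:R.
  have st := smooth_frame_trace q.
  have sf := smooth_frame_form q.
  rewrite -(tangent_add Uo Ux (ex p) (sf k l) (sf l k)).
  rewrite mulrAC -(tangent_scale Uo Ux (ex p) _ st).
  apply/esym/(tangent_congr Uo Ux (ex p)).
    by apply: smooth_on_mul => //; exact: smooth_on_cst.
  by move=> y Uy; rewrite frame_form_anti // mulrAC.
rewrite !curv_form_entry /curv_trace.
have T1 : \sum_m bracket_coef m i j x * frame_form m x k l
  + \sum_m bracket_coef m i j x * frame_form m x l k
  = 2 * (\sum_m bracket_coef m i j x * frame_trace m x) * (k == l)%:R.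
  rewrite -big_split mulr_sumr mulr_suml; apply: eq_bigr => m _ /=.
  by rewrite -mulrDr frame_form_anti //; ring.
have T2 : (frame_form i x *m frame_form j x - frame_form j x *m frame_form i x) k l
  + (frame_form i x *m frame_form j x - frame_form j x *m frame_form i x) l k = 0.
  have [p hp] := cform_co W eU Ux (ex i); have [q hq] := cform_co W eU Ux (ex j).
  have /matrixP/(_ k l) := co_lie_commutator hp hq; rewrite mxE [RHS]mxE.
  by rewrite -!/(frame_form _ _) => ->; rewrite addrN.
have := D i j; have := D j i; lra.
Qed.

Lemma co_tr_curv_form i j x : U x ->
  co_tr (curv_form i j x) = curv_trace i j x.
Proof.
move=> Ux; have n0 : n%:R != 0 :> R by rewrite pnatr_eq0 -lt0n.
rewrite /co_tr /mxtrace (eq_bigr (fun _ => curv_trace i j x)) => [|k _].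
  by rewrite sumr_const card_ord -[_ *+ n]mulr_natr mulfK.
have := curv_form_sym i j k k Ux; rewrite eqxx mulr1; lra.
Qed.

(** ** The Faraday curvature *)

(** The Gram matrix of a conformal frame is scalar.  Writing the density as a power
    of a smooth positive function shows that it is smooth, without which its
    derivatives would be zero by convention. *)
Lemma lg_frame : exists (p : M -> R) (b : R),
  [/\ smooth_on U p, forall x, U x -> 0 < p x &
      forall x, U x -> lg g e x = p x `^ b].
Proof.
have gr := class_riemannian; have [_ eC eS] := eU.
pose i0 : 'I_n := Ordinal n_gt0.
exists (fun x => g x (e x i0) (e x i0) ^+ n), (2^-1 * (- n%:R^-1)); split.
- by apply: smooth_on_exp => //; exact: (riem_smooth gr Uo (eS i0) (eS i0)).
- move=> x /eC [_ _ /(_ g hg) [t t0 ->]].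
  by rewrite eqxx exprn_gt0 // exprn_gt0.
- move=> x /eC [_ _ /(_ g hg) [t t0 gt]]; rewrite /lg.
  rewrite (_ : \matrix_(i, j) _ = (t ^+ 2)%:M); last first.
    by apply/matrixP => i j; rewrite !mxE gt.
  rewrite det_scalar gt eqxx powRrM powR12_sqrt //.
  by rewrite exprn_ge0 // exprn_ge0 // ltW.
Qed.

Lemma conn_trace_comb x (b : 'I_n -> R) : U x ->
  co_tr (W e x (fun f => \sum_l b l * e x l f)) = \sum_l b l * frame_trace l x.
Proof.
move=> Ux; rewrite conn_comb // /frame_trace /co_tr raddf_sum /= mulr_suml.
by apply: eq_bigr => l _; rewrite mxtraceZ mulrA.
Qed.

(** The two forms theta and co_tr differ by the logarithmic derivative of the
    density lg, which is closed. *)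
Lemma faraday_curv_trace x i j : U x ->
  faraday W g e (fr_vf e i) (fr_vf e j) x = curv_trace i j x.
Proof.
move=> Ux; have [p [b [ps p0 lgE]]] := lg_frame.
have ex m := frame_tangent m Ux.
(* The inverse of lg is again a power of p, hence smooth. *)
pose L y := p y `^ b; pose K y := p y `^ (- b).
have Ls : smooth_on U L by exact: smooth_on_powR.
have Ks : smooth_on U K by exact: smooth_on_powR.
have L0 y : U y -> L y != 0 by move=> /p0 py; rewrite gt_eqF // powR_gt0.
have KE y : K y = (L y)^-1 by rewrite /K powRN.
have sg : smooth_on U (lg g e) by apply: smooth_on_congr Ls => // y /lgE.
have dL m y : U y -> e y m (lg g e) = e y m L.
  by move=> Uy; apply: (tangent_congr Uo Uy (frame_tangent m Uy)).
have dLs m : smooth_on U (fun y => e y m L) by exact: smooth_frame_der.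
have st := smooth_frame_trace.
have thE m y : U y -> theta W g e (fr_vf e m) y = e y m L * K y + frame_trace m y.
  move=> Uy; rewrite /theta /covL /fr_vf mul1r dL // lgE // -/(L y) mulrDl mulfK ?L0 //.
  by rewrite KE.
have dth l m : fr_vf e l x (theta W g e (fr_vf e m)) =
    e x l (fun y => e y m L) * K x + e x m L * e x l K + e x l (frame_trace m).
  have s1 := smooth_on_mul Uo (dLs m) Ks.
  rewrite -(tangent_mul Uo Ux (ex l) (dLs m) Ks) -(tangent_add Uo Ux (ex l) s1 (st m)).
  apply/esym/(tangent_congr Uo Ux (ex l)); first exact: smooth_on_add.
  by move=> y Uy; rewrite thE.
have dK l : e x l K = - e x l L * K x ^+ 2.
  have := tangent_cst Uo Ux (ex l) 1.
  rewrite -(tangent_congr (f := fun y => L y * K y) Uo Ux (ex l)); first last.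
  - by move=> y Uy; rewrite KE divff ?L0.
  - exact: smooth_on_mul.
  rewrite (tangent_mul Uo Ux (ex l) Ls Ks) addrC => /eqP.
  rewrite addr_eq0 => /eqP h; have KL : K x * L x = 1 by rewrite KE mulVf ?L0.
  by rewrite -[LHS]mul1r -KL -mulrA h; ring.
rewrite /faraday /curv_trace (dth i j) (dth j i) !dK.
rewrite /theta /covL bracket_frame // conn_trace_comb // lgE // -/(L x) mul1r.
rewrite mulrDl mulfK ?L0 // -KE.
under eq_bigr => l _ do rewrite dL //.
by rewrite -(frame_commutator i j Uo (@subset_refl _ U) Ux Ls); ring.
Qed.

End WeylFrame.

(** * The Clifford algebra and its representation *)

Section CliffordRepresentation.
Variables (R : realType) (n : nat) (gam : 'I_n -> spinor_mx R n).
Hypothesis hgam : clifford_rep gam.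

Lemma cmul_delta i : cmul gam (delta_mx i 0) = gam i.
Proof.
rewrite /cmul (bigD1 i) //= big1 => [|k /negbTE ki].
  by rewrite mxE !eqxx scale1r addr0.
by rewrite mxE ki scale0r.
Qed.

Lemma cmulD x y : cmul gam (x + y) = cmul gam x + cmul gam y.
Proof.
rewrite /cmul -big_split; apply: eq_bigr => i _ /=.
by rewrite mxE rmorphD scalerDl.
Qed.

Lemma gam_sqr i : gam i *m gam i = - 1%:M.
Proof.
rewrite -[gam i]cmul_delta hgam (bigD1 i) //= big1 => [|k /negbTE ki].
  by rewrite mxE !eqxx expr1n addr0.
by rewrite mxE ki expr0n.
Qed.

Lemma gam_anticomm i j : i != j -> gam i *m gam j = - (gam j *m gam i).
Proof.
move=> ij; have := hgam (delta_mx i 0 + delta_mx j 0).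
rewrite cmulD !cmul_delta mulmxDl !mulmxDr !gam_sqr.
rewrite (bigD1 i) // (bigD1 j) /= 1?eq_sym // big1 => [|k /andP[/negbTE ki /negbTE kj]];
  last by rewrite !mxE ki kj addr0 expr0n.
rewrite !mxE !eqxx (negbTE ij) eq_sym (negbTE ij) addr0 add0r addr0 expr1n.
rewrite !rmorphD /= !rmorph1 opprD -!addrA => /addrI; rewrite addrA.
rewrite -[RHS]add0r => /addIr /eqP.
by rewrite addr_eq0 => /eqP.
Qed.

(** The Clifford relation, in the form in which products are reordered. *)
Lemma gam_swap i j : gam i *m gam j = - (gam j *m gam i) - (2 * (i == j)%:R)%:M.
Proof.
have [<-|ij] := eqVneq i j; last by rewrite mulr0 raddf0 subr0 gam_anticomm.
by rewrite gam_sqr opprK mulr1 -[2]/(1 + 1) raddfD /= opprD addNKr.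
Qed.

Lemma cl_vec_delta k (S : {set 'I_n}) :
  cl_vec (delta_mx k 0 : 'cV[R]_n) S = (S == [set k]%SET)%:R.
Proof.
rewrite ffunE (bigD1 k) //= mxE !eqxx big1 ?addr0 // => i /negbTE ik.
by rewrite mxE ik mul0rn.
Qed.

Lemma cl_mul_delta k l (S : {set 'I_n}) :
  cl_mul (cl_vec (delta_mx k 0 : 'cV[R]_n)) (cl_vec (delta_mx l 0)) S =
  cl_sign R [set k]%SET [set l]%SET
  * ((([set k] :\: [set l]) :|: ([set l] :\: [set k]))%SET == S)%:R.
Proof.
rewrite ffunE (bigD1 [set k]%SET) //= [X in _ + X]big1 => [|T /negbTE Tk]; last first.
  by apply: big1 => T' _; rewrite cl_vec_delta Tk mulr0 mul0r.
rewrite addr0 big_mkcond (bigD1 [set l]%SET) //= big1 => [|T /negbTE Tl]; last first.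
  by rewrite cl_vec_delta [X in _ * X]cl_vec_delta Tl mulr0 if_same.
rewrite addr0 !cl_vec_delta !eqxx !mulr1.
by case: eqP => _; rewrite ?mulr1 ?mulr0.
Qed.

Lemma cl_sign_delta (k l : 'I_n) :
  cl_sign R [set k]%SET [set l]%SET = (-1) ^+ (l <= k)%N.
Proof.
rewrite /cl_sign; congr (_ ^+ _).
have [lk|kl] := boolP (l <= k)%N.
  rewrite (@fintype.eq_card1 _ (k, l)) // => -[p q]; rewrite !inE /= xpair_eqE.
  by case: eqP => [->|//]; case: eqP => [->|//].
apply: fintype.eq_card0 => -[p q]; rewrite !inE /=.
by case: eqP => [->|//]; case: eqP => [->|//]; exact/negbTE.
Qed.

Lemma enum_pair (k l : 'I_n) : (k < l)%N -> enum [set k; l]%SET = [:: k; l].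
Proof.
move=> kl; apply: (@irr_sorted_eq _ (fun i j : 'I_n => (i < j)%N)).
- by move=> a b d; exact: ltn_trans.
- by move=> a; rewrite /= ltnn.
- rewrite {1}/enum_mem -enumT; apply: sorted_filter; first by move=> a b d; exact: ltn_trans.
  by rewrite -(@sorted_map _ _ val ltn) val_enum_ord iota_ltn_sorted.
- by rewrite /= kl.
by move=> i; rewrite mem_enum !inE.
Qed.

(** Ordered products represent basis elements, so only the pairs with l <= k need
    the Clifford relation, and it yields the sign of [cl_sign]. *)
Lemma kappa_delta_mul k l :
  kappa gam (cl_mul (cl_vec (delta_mx k 0)) (cl_vec (delta_mx l 0))) =
  gam k *m gam l.
Proof.
set S0 := (([set k] :\: [set l]) :|: ([set l] :\: [set k]))%SET.
rewrite /kappa (bigD1 S0) //= big1 => [|S SS0]; last first.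
  by rewrite cl_mul_delta -/S0 eq_sym (negbTE SS0) mulr0 scale0r.
rewrite cl_mul_delta -/S0 eqxx mulr1 addr0 cl_sign_delta.
have [kl|lk|kl] := ltngtP k l.
- rewrite expr0 scale1r (_ : S0 = [set k; l]%SET); last first.
    apply/setP => i; rewrite !inE; case: (eqVneq i k) => [->|_] /=.
      by rewrite andbT -(inj_eq val_inj) /= (ltn_eqF kl).
    by case: (i == l).
  by rewrite enum_pair // !big_cons big_nil mulmx1.
- rewrite expr1 (_ : S0 = [set l; k]%SET); last first.
    apply/setP => i; rewrite !inE; case: (eqVneq i k) => [->|_] /=.
      by rewrite andbT -(inj_eq val_inj) /= (gtn_eqF lk) orbT.
    by case: (i == l).
  rewrite enum_pair // !big_cons big_nil mulmx1 rmorphN1 scaleN1r gam_anticomm ?opprK //.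
  by rewrite -(inj_eq val_inj) /= (ltn_eqF lk).
have -> : S0 = finset.set0.
  by rewrite /S0 (val_inj kl) finset.setDv finset.setU0.
by rewrite enum_set0 big_nil expr1 rmorphN1 scaleN1r (val_inj kl) gam_sqr.
Qed.

Definition spin_rep (B : 'M[R]_n) : spinor_mx R n :=
  \sum_k \sum_l (4^-1 * B l k)%:C *: (gam k *m gam l).

Lemma kappa_spin_lie B : kappa gam (spin_lie B) = spin_rep B.
Proof.
rewrite /kappa /spin_rep.
under eq_bigr => S _ do rewrite ffunE mulr_sumr rmorph_sum scaler_suml.
rewrite exchange_big; apply: eq_bigr => k _ /=.
under eq_bigr => S _ do rewrite mulr_sumr rmorph_sum scaler_suml.
rewrite exchange_big; apply: eq_bigr => l _ /=.
rewrite -kappa_delta_mul /kappa scaler_sumr; apply: eq_bigr => S _.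
by rewrite mulrA rmorphM scalerA.
Qed.

End CliffordRepresentation.

Lemma sum_delta (A : nzRingType) (n : nat) (V : lmodType A) (i : 'I_n)
    (F : 'I_n -> V) : \sum_k (i == k)%:R *: F k = F i.
Proof.
rewrite (bigD1 i) //= eqxx scale1r big1 ?addr0 // => k /negbTE ki.
by rewrite eq_sym ki scale0r.
Qed.

(** * Contractions of Clifford products *)

Section CliffordIdentities.
Variables (R : realType) (n : nat) (gam : 'I_n -> spinor_mx R n).
Hypothesis hgam : clifford_rep gam.
Local Notation spin := (spin_rep gam).

Lemma gam_cycle i j k : gam i *m gam j *m gam k - gam k *m gam i *m gam j =
  2 * (i == k)%:R *: gam j - 2 * (j == k)%:R *: gam i.
Proof.
rewrite -[X in X - _]mulmxA (gam_swap hgam j k) mulmxBr mulmxN mulmxA.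
rewrite (gam_swap hgam i k) mulmxBl mulNmx mul_scalar_mx mul_mx_scalar.
move: (_ *m _ *m _) => A; apply/matrixP => p q; rewrite !mxE; ring.
Qed.

Lemma spin_repD A B : spin (A + B) = spin A + spin B.
Proof.
rewrite /spin_rep -big_split; apply: eq_bigr => k _ /=.
rewrite -big_split; apply: eq_bigr => l _ /=.
by rewrite mxE mulrDr rmorphD scalerDl.
Qed.

Lemma spin_repZ a A : spin (a *: A) = a%:C *: spin A.
Proof.
rewrite /spin_rep scaler_sumr; apply: eq_bigr => k _.
rewrite scaler_sumr; apply: eq_bigr => l _.
by rewrite mxE scalerA -rmorphM mulrCA.
Qed.

Lemma spin_repN A : spin (- A) = - spin A.
Proof. by rewrite -scaleN1r spin_repZ rmorphN1 scaleN1r. Qed.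

Lemma spin_repB A B : spin (A - B) = spin A - spin B.
Proof. by rewrite spin_repD spin_repN. Qed.

(** The commutator with [spin_rep gam B] is the standard action of [B] on vectors;
    this is the differential of the covering Spin(n) -> SO(n). *)
Lemma spin_rep_vec (B : 'M[R]_n) m : (forall k l, B k l = - B l k) ->
  spin B *m gam m - gam m *m spin B = \sum_l (B l m)%:C *: gam l.
Proof.
move=> Banti; rewrite /spin_rep mulmx_suml mulmx_sumr -sumrB.
transitivity (\sum_k \sum_l (m == l)%:R *: ((- (4^-1 * B l k)%:C * 2) *: gam k)
             + \sum_k (m == k)%:R *: \sum_l ((4^-1 * B l k)%:C * 2) *: gam l).
  rewrite -big_split; apply: eq_bigr => k _ /=.
  rewrite mulmx_suml mulmx_sumr -sumrB scaler_sumr -big_split.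
  apply: eq_bigr => l _ /=.
  rewrite -scalemxAl -scalemxAr -scalerBr mulmxA gam_cycle.
  rewrite ![_ == m]eq_sym; move: (_%:C) => z.
  by apply/matrixP => p q; rewrite !mxE; ring.
under eq_bigr => k _ do rewrite sum_delta.
rewrite sum_delta -big_split; apply: eq_bigr => l _ /=.
rewrite -scalerDl (Banti m l) mulrN rmorphN opprK; congr (_ *: _).
rewrite -mulrDr -natrD -(rmorph_nat (real_complex R)) -rmorphM; congr (_%:C).
by field.
Qed.

(** A commutator is a derivation, so [spin_rep_vec] gives the commutator with each
    product of two generators. *)
Lemma spin_rep_commutator (B D : 'M[R]_n) :
  (forall k l, B k l = - B l k) -> (forall k l, D k l = - D l k) ->
  spin B *m spin D - spin D *m spin B = spin (B *m D - D *m B).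
Proof.
move=> Banti Danti.
have step k l : spin B *m (gam k *m gam l) - gam k *m gam l *m spin B =
    \sum_m (B m k)%:C *: (gam m *m gam l) + \sum_m (B m l)%:C *: (gam k *m gam m).
  transitivity ((spin B *m gam k - gam k *m spin B) *m gam l
                + gam k *m (spin B *m gam l - gam l *m spin B)).
    by rewrite mulmxBl mulmxBr !mulmxA subrKA.
  rewrite !spin_rep_vec // mulmx_suml mulmx_sumr; congr (_ + _).
    by apply: eq_bigr => m _; rewrite scalemxAl.
  by apply: eq_bigr => m _; rewrite -scalemxAr.
rewrite {2 3}/spin_rep mulmx_sumr mulmx_suml -sumrB.
under eq_bigr => k _.
  rewrite mulmx_sumr mulmx_suml -sumrB.
  under eq_bigr => l _ do rewrite -scalemxAl -scalemxAr -scalerBr step scalerDr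
    !scaler_sumr.
  rewrite big_split /=.
  over.
rewrite big_split /= spin_repB addrC; congr (_ + _).
  rewrite {1}/spin_rep; apply: eq_bigr => k _.
  rewrite exchange_big; apply: eq_bigr => l _ /=.
  rewrite mxE mulr_sumr rmorph_sum scaler_suml; apply: eq_bigr => m _.
  by rewrite scalerA -rmorphM -mulrA [D _ _ * _]mulrC.
rewrite -spin_repN /spin_rep exchange_big.
transitivity (\sum_l \sum_m \sum_k
   (4^-1 * D l k)%:C *: ((B m k)%:C *: (gam m *m gam l))).
  by apply: eq_bigr => l _; exact: exchange_big.
rewrite exchange_big; apply: eq_bigr => m _; apply: eq_bigr => l _ /=.
rewrite !mxE -sumrN mulr_sumr rmorph_sum scaler_suml; apply: eq_bigr => k _.
rewrite scalerA -rmorphM (Banti m k); congr (_%:C *: _); ring.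
Qed.

(** Splitting [X] into its symmetric part, on which the Clifford product is a
    trace, and its antisymmetric part. *)
Lemma clifford_contract p (X : 'I_n -> 'I_n -> 'M[R[i]]_(2 ^ n./2, p)) :
  2 *: \sum_i \sum_j gam i *m gam j *m X i j =
  \sum_i \sum_j gam i *m gam j *m (X i j - X j i) - 2 *: \sum_i X i i.
Proof.
rewrite scaler_nat mulr2n.
have {2}-> : \sum_i \sum_j gam i *m gam j *m X i j =
    - \sum_i \sum_j gam i *m gam j *m X j i - 2 *: \sum_i X i i.
  rewrite [X in - X]exchange_big -sumrN scaler_sumr -sumrB.
  apply: eq_bigr => i _ /=; rewrite -[X in _ - _ *: X](sum_delta i (X i)).
  rewrite -sumrN scaler_sumr -sumrB; apply: eq_bigr => j _ /=.
  by rewrite (gam_swap hgam i j) mulmxBl mulNmx mul_scalar_mx scalerA.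
rewrite addrA -sumrB; congr (_ - _); apply: eq_bigr => i _ /=.
by rewrite -sumrB; apply: eq_bigr => j _ /=; rewrite mulmxBr.
Qed.

(** Bringing the cyclic permutations of a triple product into the same order costs
    only contractions, by [gam_cycle].  When [T] satisfies a Bianchi identity the
    cyclic sum vanishes, and the triple product reduces to a vector. *)
Lemma clifford_triple (T : 'I_n -> 'I_n -> 'I_n -> R[i]) :
  (forall i j k, T i j k = - T j i k) ->
  3 *: \sum_i \sum_j \sum_k T i j k *: (gam i *m gam j *m gam k) =
  \sum_i \sum_j \sum_k (T i j k + T j k i + T k i j) *: (gam i *m gam j *m gam k)
  + 6 *: \sum_i \sum_j T i j i *: gam j.
Proof.
move=> Tanti; pose E i j k := T i j k *: (gam i *m gam j *m gam k).
have rot (F : 'I_n -> 'I_n -> 'I_n -> 'M[R[i]]_(2 ^ n./2)) :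
    \sum_i \sum_j \sum_k F j k i = \sum_i \sum_j \sum_k F i j k.
  by rewrite exchange_big; apply: eq_bigr => j _; rewrite exchange_big.
pose F1 i j k := T i j k *: (gam k *m gam i *m gam j).
pose F2 i j k := T i j k *: (gam j *m gam k *m gam i).
have {1}-> : \sum_i \sum_j \sum_k (T i j k + T j k i + T k i j) *:
     (gam i *m gam j *m gam k) =
   \sum_i \sum_j \sum_k (E i j k + F1 i j k + F2 i j k).
  transitivity (\sum_i \sum_j \sum_k E i j k + \sum_i \sum_j \sum_k F1 j k i
     + \sum_i \sum_j \sum_k F2 k i j).
    rewrite -!big_split; apply: eq_bigr => i _ /=.
    rewrite -!big_split; apply: eq_bigr => j _ /=.
    by rewrite -!big_split; apply: eq_bigr => k _ /=; rewrite !scalerDl.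
  transitivity (\sum_i \sum_j \sum_k E i j k + \sum_i \sum_j \sum_k F1 i j k
     + \sum_i \sum_j \sum_k F2 i j k).
    exact: (congr2 +%R (congr1 (+%R _) (rot F1))
      (etrans (rot (fun i j k => F2 j k i)) (rot F2))).
  rewrite -!big_split; apply: eq_bigr => i _ /=; rewrite -!big_split.
  by apply: eq_bigr => j _ /=; rewrite -!big_split.
have T0 i k : T i i k = 0.
  have /eqP := Tanti i i k; rewrite -addr_eq0 -mulr2n mulrn_eq0 /=.
  by move/eqP.
(* The three contractions of T: the first contributes twice, the second is
   minus the first by antisymmetry, and the third vanishes. *)
have -> : \sum_i \sum_j \sum_k (E i j k + F1 i j k + F2 i j k) =
    3 *: \sum_i \sum_j \sum_k E i j k
    - \sum_i \sum_j \sum_k (i == k)%:R *: ((4 * T i j k) *: gam j)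
    + \sum_i \sum_j \sum_k (j == k)%:R *: ((2 * T i j k) *: gam i)
    + \sum_i \sum_j (i == j)%:R *: \sum_k (2 * T i j k) *: gam k.
  rewrite scaler_sumr -sumrB -!big_split; apply: eq_bigr => i _ /=.
  rewrite scaler_sumr -sumrB -!big_split; apply: eq_bigr => j _ /=.
  rewrite !scaler_sumr -sumrB -!big_split; apply: eq_bigr => k _ /=.
  have := gam_cycle i j k; have := gam_cycle j k i; rewrite /E /F1 /F2.
  rewrite [j == i]eq_sym [k == i]eq_sym.
  move: (gam i *m _ *m _) (gam j *m _ *m _) (gam k *m _ *m _) => A B D hB hD.
  have -> : D = A - (2 * (i == k)%:R *: gam j - 2 * (j == k)%:R *: gam i).
    by rewrite -hD opprB addrC subrK.
  have -> : B = A + (2 * (i == j)%:R *: gam k - 2 * (i == k)%:R *: gam j).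
    by rewrite -hB addrC subrK.
  by apply/matrixP => p q; rewrite !mxE; ring.
rewrite [X in _ - X](_ : _ = 4 *: \sum_i \sum_j T i j i *: gam j); last first.
  rewrite scaler_sumr; apply: eq_bigr => i _; rewrite scaler_sumr.
  by apply: eq_bigr => j _; rewrite sum_delta scalerA.
rewrite [X in _ - _ + X](_ : _ = - (2 *: \sum_i \sum_j T i j i *: gam j)); last first.
  rewrite exchange_big scaler_sumr -sumrN; apply: eq_bigr => j _ /=.
  rewrite scaler_sumr -sumrN; apply: eq_bigr => i _ /=.
  by rewrite sum_delta Tanti mulrN scaleNr scalerA.
rewrite [X in _ - _ + _ + X + _]big1 => [|i _]; last first.
  by rewrite sum_delta big1 // => k _; rewrite T0 mulr0 scale0r.
rewrite addr0 /E; move: (\sum_i _) (\sum_i _) => A B.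
by apply/matrixP => p q; rewrite !mxE; ring.
Qed.

End CliffordIdentities.

(** * The curvature term *)

Section CurvatureTerm.
Variables (R : realType) (n : nat) (gam : 'I_n -> spinor_mx R n).
Hypotheses (n_gt0 : (0 < n)%N) (hgam : clifford_rep gam).
Local Notation spin := (spin_rep gam).

Variables (Om : 'I_n -> 'I_n -> 'M[R]_n).
Let F i j := co_tr (Om i j).
Hypothesis Om_anti : forall i j, Om i j = - Om j i.
Hypothesis Om_sym : forall i j k l,
  Om i j k l + Om i j l k = 2 * F i j * (k == l)%:R.
Hypothesis Om_bianchi : forall i j k m,
  Om i j m k + Om j k m i + Om k i m j = 0.

Let n0 : n%:R != 0 :> R. Proof. by rewrite pnatr_eq0 -lt0n. Qed.

Let F_anti i j : F i j = - F j i.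
Proof. by rewrite /F Om_anti /co_tr raddfN mulNr. Qed.

Let trE i j : \sum_k Om i j k k = n%:R * F i j.
Proof. by rewrite /F /co_tr mulrC divfK. Qed.

Let Phi := \sum_i \sum_j (F i j)%:C *: (gam i *m gam j).
Let ric j k := \sum_i Om i j i k.

Let ric_skew j k : ric j k - ric k j = - (n%:R * F j k).
Proof.
apply/eqP; rewrite -addr_eq0 addrAC -trE /ric -sumrN -!big_split.
rewrite big1 // => i _ /=.
by rewrite -(Om_bianchi i j k i) [Om k i]Om_anti mxE.
Qed.

(** The contracted Bianchi identity makes the skew part of the Ricci tensor equal to
    -n/2 times the Faraday curvature; the symmetric part contributes its trace. *)
Lemma clifford_ricci :
  2 *: \sum_j \sum_l (ric j l)%:C *: (gam j *m gam l) =
  - (n%:R *: Phi) - (2 * (\sum_j ric j j)%:C)%:M.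
Proof.
have := clifford_contract hgam (fun j l => (ric j l)%:C%:M).
under eq_bigr => j _ do under eq_bigr => l _ do rewrite mul_mx_scalar.
under [X in _ = X - _ -> _]eq_bigr => j _ do under eq_bigr => l _ do
  rewrite -raddfB /= mul_mx_scalar -rmorphB ric_skew rmorphN rmorphM scaleNr
    -scalerA rmorph_nat.
move=> ->; congr (_ - _).
  by rewrite scaler_sumr -sumrN; apply: eq_bigr => j _; rewrite scaler_sumr sumrN.
by rewrite -raddf_sum scale_scalar_mx rmorph_sum.
Qed.

Lemma spin_rep_scalar (a : R) : spin a%:M = - (4^-1 * (n%:R * a%:C))%:M.
Proof.
rewrite /spin_rep.
transitivity (\sum_(k < n) - (4^-1 * a%:C)%:M : spinor_mx R n).
  apply: eq_bigr => k _; rewrite (bigD1 k) //= big1 => [|l /negbTE lk].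
    rewrite addr0 mxE eqxx gam_sqr // scalerN scale_scalar_mx mulr1.
    by rewrite rmorphM fmorphV rmorph_nat.
  by rewrite mxE lk mulr0n mulr0 scale0r.
rewrite sumr_const card_ord mulNrn -scaler_nat scale_scalar_mx.
by congr (- _%:M); ring.
Qed.

(** For the contraction of four generators, [clifford_triple] is applied to the
    first three.  The Bianchi identity holds for [Om] but not for its part in
    so(n), so the scalar part [F] is separated only afterwards. *)
Lemma clifford_curvature :
  2 *: \sum_i \sum_j gam i *m gam j *m spin (co_so (Om i j)) =
  (\sum_j ric j j)%:C%:M + (n%:R - 2) *: Phi.
Proof.
pose G l := \sum_i \sum_j \sum_k
  (Om i j l k)%:C *: (gam i *m gam j *m gam k).
have GE l : G l = 2 *: \sum_i \sum_j (Om i j l i)%:C *: gam j.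
  have Tanti i j k : (Om i j l k)%:C = - (Om j i l k)%:C.
    by rewrite Om_anti mxE rmorphN.
  have /= h := clifford_triple hgam Tanti.
  have three : 3 != 0 :> R[i] by rewrite pnatr_eq0.
  apply: (scalerI three); rewrite /G h big1 => [|i _]; last first.
    apply: big1 => j _; apply: big1 => k _.
    by rewrite -!rmorphD Om_bianchi rmorph0 scale0r.
  by rewrite add0r scalerA -natrM.
have spinE : 4 *: \sum_i \sum_j gam i *m gam j *m spin (Om i j) =
    \sum_l G l *m gam l.
  transitivity (\sum_i \sum_j \sum_k \sum_l
      (Om i j l k)%:C *: (gam i *m gam j *m gam k *m gam l)).
    rewrite scaler_sumr; apply: eq_bigr => i _.
    rewrite scaler_sumr; apply: eq_bigr => j _.
    rewrite /spin_rep mulmx_sumr scaler_sumr; apply: eq_bigr => k _.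
    rewrite mulmx_sumr scaler_sumr; apply: eq_bigr => l _.
    rewrite -scalemxAr scalerA !mulmxA; congr (_ *: _).
    by rewrite -(rmorph_nat (real_complex R)) -rmorphM mulrA divff ?mul1r // pnatr_eq0.
  rewrite [RHS](_ : _ = \sum_l \sum_i \sum_j \sum_k
      (Om i j l k)%:C *: (gam i *m gam j *m gam k *m gam l)); last first.
    apply: eq_bigr => l _; rewrite /G mulmx_suml; apply: eq_bigr => i _.
    rewrite mulmx_suml; apply: eq_bigr => j _; rewrite mulmx_suml.
    by apply: eq_bigr => k _; rewrite -scalemxAl.
  rewrite [RHS]exchange_big; apply: eq_bigr => i _ /=.
  rewrite [RHS]exchange_big; apply: eq_bigr => j _ /=.
  by rewrite [RHS]exchange_big.
(* Om i j l i is minus Om i j i l, plus 2 F i j when i = l. *)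
have GricE : \sum_l G l *m gam l =
    - (2 *: \sum_j \sum_l (ric j l)%:C *: (gam j *m gam l)) - 4 *: Phi.
  transitivity (2 *: \sum_j \sum_l (2 * F l j - ric j l)%:C *: (gam j *m gam l)).
    rewrite [X in _ = _ *: X]exchange_big scaler_sumr; apply: eq_bigr => l _ /=.
    rewrite GE -scalemxAl exchange_big mulmx_suml; congr (_ *: _).
    apply: eq_bigr => j _; rewrite -scaler_suml -scalemxAl; congr (_ *: _).
    rewrite -rmorph_sum; congr (_%:C).
    transitivity (\sum_i ((l == i)%:R *: (2 * F i j : R^o) - Om i j i l)).
      apply: eq_bigr => i _; have := Om_sym i j i l; rewrite eq_sym.
      by rewrite -[_ *: _]/(_ * _) => /(canRL (addKr _)) ->; rewrite addrC mulrC.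
    by rewrite sumrB sum_delta.
  have -> : 4 = 2 * 2 :> R[i] by rewrite -natrM.
  rewrite -scalerA -opprD -scalerDr -scalerN; congr (_ *: _).
  rewrite /Phi scaler_sumr -big_split -sumrN; apply: eq_bigr => j _ /=.
  rewrite scaler_sumr -big_split -sumrN; apply: eq_bigr => l _ /=.
  rewrite scalerA -scalerDl -scaleNr; congr (_ *: _).
  rewrite -(rmorph_nat (real_complex R)) -rmorphM -rmorphD -rmorphN; congr (_%:C).
  by rewrite (F_anti j l); ring.
have scalarE : 4 *: \sum_i \sum_j gam i *m gam j *m spin (F i j)%:M = - (n%:R *: Phi).
  rewrite /Phi !scaler_sumr -sumrN; apply: eq_bigr => i _.
  rewrite !scaler_sumr -sumrN; apply: eq_bigr => j _.
  rewrite spin_rep_scalar mulmxN mul_mx_scalar scalerN !scalerA; congr (- (_ *: _)).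
  by field.
have two : 2 != 0 :> R[i] by rewrite pnatr_eq0.
apply: (scalerI two); rewrite scalerA -natrM.
transitivity (4 *: \sum_i \sum_j gam i *m gam j *m spin (Om i j)
    - 4 *: \sum_i \sum_j gam i *m gam j *m spin (F i j)%:M).
  rewrite -scalerBr -sumrB; congr (_ *: _); apply: eq_bigr => i _.
  by rewrite -sumrB; apply: eq_bigr => j _; rewrite /co_so spin_repB mulmxBr.
rewrite spinE GricE clifford_ricci scalarE.
move: Phi (\sum_j ric j j)%:C => P a.
apply/matrixP => p q; rewrite !mxE; case: (p == q); rewrite ?mulr1n ?mulr0n; ring.
Qed.

End CurvatureTerm.

(** * The action of co(n) on spinors of weight w *)

Section DifferentialOfKappa.
Variables (R : realType) (n : nat) (gam : 'I_n -> spinor_mx R n).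
Hypotheses (n_gt0 : (0 < n)%N) (hgam : clifford_rep gam).
Variable w : R.
Local Notation spin := (spin_rep gam).
Local Notation dk := (dkappaw gam w).

Lemma dkappawE B : dk B = spin (co_so B) + (w * co_tr B)%:C%:M.
Proof. by rewrite /dkappaw kappa_spin_lie. Qed.

Lemma co_trD (A B : 'M[R]_n) : co_tr (A + B) = co_tr A + co_tr B.
Proof. by rewrite /co_tr raddfD mulrDl. Qed.

Lemma co_trZ a (A : 'M[R]_n) : co_tr (a *: A) = a * co_tr A.
Proof. by rewrite /co_tr mxtraceZ mulrA. Qed.

Lemma dkappawD A B : dk (A + B) = dk A + dk B.
Proof.
have coD : co_so (A + B) = co_so A + co_so B.
  by rewrite /co_so co_trD raddfD opprD addrACA.
by rewrite !dkappawE coD spin_repD co_trD mulrDr rmorphD raddfD addrACA.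
Qed.

Lemma dkappawZ a A : dk (a *: A) = a%:C *: dk A.
Proof.
have coZ : co_so (a *: A) = a *: co_so A.
  by rewrite /co_so co_trZ -scale_scalar_mx -scalerBr.
by rewrite !dkappawE coZ spin_repZ co_trZ scalerDr scale_scalar_mx -rmorphM mulrCA.
Qed.

Lemma dkappawN A : dk (- A) = - dk A.
Proof. by rewrite -scaleN1r dkappawZ rmorphN1 scaleN1r. Qed.

Lemma dkappaw_sum (I : Type) (r : seq I) (F : I -> 'M[R]_n) :
  dk (\sum_(i <- r) F i) = \sum_(i <- r) dk (F i).
Proof.
apply: (big_morph dk dkappawD).
by rewrite -(scale0r 0) dkappawZ scale0r.
Qed.

Lemma dkappaw_delta B : dk B = \sum_k \sum_l (B k l)%:C *: dk (delta_mx k l).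
Proof.
rewrite {1}(matrix_sum_delta B) dkappaw_sum; apply: eq_bigr => k _.
by rewrite dkappaw_sum; apply: eq_bigr => l _; rewrite dkappawZ.
Qed.

(** Scalar parts are central and a commutator has trace 0, so this is the statement
    for the parts in so(n). *)
Lemma dkappaw_commutator (A B : 'M[R]_n) : co_lie A -> co_lie B ->
  dk A *m dk B - dk B *m dk A = dk (A *m B - B *m A).
Proof.
move=> hA hB; rewrite !dkappawE.
have tr0 : co_tr (A *m B - B *m A) = 0.
  by rewrite /co_tr linearB /= mxtrace_mulC subrr mul0r.
rewrite [RHS](_ : _ = spin (A *m B - B *m A)); last first.
  have s0 m (K : nzRingType) : scalar_mx 0 = 0 :> 'M[K]_m by rewrite raddf0.
  by rewrite /co_so tr0 mulr0 rmorph0 !s0 subr0 addr0.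
have -> : A *m B - B *m A = co_so A *m co_so B - co_so B *m co_so A.
  rewrite /co_so !mulmxBl !mulmxBr !mul_scalar_mx !mul_mx_scalar !scale_scalar_mx.
  move: (A *m B) (B *m A) => P Q.
  by apply/matrixP => k l; rewrite !mxE; case: (k == l); rewrite ?mulr1n ?mulr0n; ring.
rewrite -spin_rep_commutator //; try exact: co_so_anti.
rewrite !mulmxDl !mulmxDr !mul_scalar_mx !mul_mx_scalar !scale_scalar_mx.
move: (spin (co_so A) *m _) (spin (co_so B) *m _) => P Q.
apply/matrixP => k l; rewrite !mxE; case: (k == l); rewrite ?mulr1n ?mulr0n; ring.
Qed.

End DifferentialOfKappa.

(** Clifford multiplication is parallel as a map from T^* tensor S^w to
    S^(w-1): the infinitesimal action of co(n) on the three bundles is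
    compatible with it. *)
Lemma dkappaw_gam (R : realType) (n : nat) (gam : 'I_n -> spinor_mx R n)
    (n_gt0 : (0 < n)%N) (hgam : clifford_rep gam) (w : R) (B : 'M[R]_n) j :
  co_lie B ->
  dkappaw gam (w - 1) B *m gam j =
  gam j *m dkappaw gam w B - \sum_l (B j l)%:C *: gam l.
Proof.
move=> hB; rewrite !dkappawE //.
have /(canRL (subrK _)) hj := spin_rep_vec hgam j (co_so_anti n_gt0 hB).
rewrite mulmxDl mulmxDr hj mul_scalar_mx mul_mx_scalar.
have -> : \sum_l (co_so B l j)%:C *: gam l =
    (co_tr B)%:C *: gam j - \sum_l (B j l)%:C *: gam l.
  rewrite -[X in _ *: X - _](sum_delta j gam) scaler_sumr -sumrB.
  apply: eq_bigr => l _; rewrite scalerA -scalerBl; congr (_ *: _).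
  rewrite /co_so !mxE -[(j == l)%:R](rmorph_nat (real_complex R)) -rmorphM -rmorphB.
  congr (_%:C); have := co_lieE n_gt0 hB l j; rewrite eq_sym.
  by case: eqVneq => _; rewrite ?mulr1n ?mulr0n; lra.
rewrite mulrBl mul1r rmorphB scalerBl.
move: (gam j *m _) (_ *: gam j) (_ *: gam j) => a b d.
by apply/matrixP => p q; rewrite !mxE; ring.
Qed.

(** * The formula at a point *)

Section WeitzenboeckAtPoint.
Variables (R : realType) (n : nat) (gam : 'I_n -> spinor_mx R n).
Hypotheses (n_gt0 : (0 < n)%N) (hgam : clifford_rep gam).
Variables (w : R) (A : 'I_n -> 'M[R]_n) (dA : 'I_n -> 'I_n -> 'M[R]_n).
Variables (psi : spinor R n) (P : 'I_n -> spinor R n) (H : 'I_n -> 'I_n -> spinor R n).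
(* The data are the values at a point of the connection matrices, of their
   derivatives and of the first and second derivatives of a spinor field in a
   frame. *)
Let tor l i j := A i l j - A j l i.
Let Om i j := dA i j - dA j i + (A i *m A j - A j *m A i)
  - \sum_l tor l i j *: A l.
Hypothesis A_co : forall i, co_lie (A i).
Hypothesis H_tor : forall i j, H i j - H j i = \sum_l (tor l i j)%:C *: P l.
Hypothesis Om_sym : forall i j k l,
  Om i j k l + Om i j l k = 2 * co_tr (Om i j) * (k == l)%:R.
Hypothesis Om_bianchi : forall i j k m,
  Om i j m k + Om j k m i + Om k i m j = 0.

Local Notation dk := (dkappaw gam w).
Let N j := P j + dk (A j) *m psi.
Let DN i j := H i j + dk (dA i j) *m psi + dk (A j) *m P i.
Let X i j := DN i j + dk (A i) *m N j - \sum_l (A i l j)%:C *: N l.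

Let Om_anti i j : Om i j = - Om j i.
Proof.
rewrite /Om; have -> : \sum_l tor l j i *: A l = - \sum_l tor l i j *: A l.
  by rewrite -sumrN; apply: eq_bigr => l _; rewrite -scaleNr /tor opprB.
by rewrite !opprD !opprK [- dA j i + _]addrC [- (A j *m _) + _]addrC.
Qed.

(** By [dkappaw_gam] the weight drops from w to w - 1 exactly when a generator is
    moved across the connection, and the covector term of that lemma is the one
    that turns the iterated derivative into the second covariant derivative. *)
Lemma dirac_square_hessian :
  \sum_i gam i *m (\sum_j gam j *m DN i j
                   + dkappaw gam (w - 1) (A i) *m \sum_j gam j *m N j) =
  \sum_i \sum_j gam i *m gam j *m X i j.
Proof.
apply: eq_bigr => i _.
under [RHS]eq_bigr => j _ do rewrite -mulmxA.
rewrite -mulmx_sumr; congr (_ *m _).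
rewrite mulmx_sumr -big_split.
transitivity (\sum_j (gam j *m (DN i j + dk (A i) *m N j)
     - \sum_l (A i j l)%:C *: (gam l *m N j))).
  apply: eq_bigr => j _ /=; rewrite mulmxA dkappaw_gam // mulmxBl addrA.
  rewrite [gam j *m (_ + _ *m N j)]mulmxDr mulmxA mulmx_suml; congr (_ - _).
  apply: eq_bigr => l _.
  by rewrite -scalemxAl.
rewrite sumrB [X in _ - X]exchange_big -sumrB; apply: eq_bigr => j _ /=.
rewrite mulmxBr mulmx_sumr; congr (_ - _); apply: eq_bigr => l _.
by rewrite -scalemxAr.
Qed.

(** The Ricci identity: the antisymmetrised second derivative is the action of
    the curvature. *)
Lemma hessian_commutator i j : X i j - X j i = dk (Om i j) *m psi.
Proof.
have -> : dk (Om i j) *m psi = dk (dA i j) *m psi - dk (dA j i) *m psi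
    + (dk (A i) *m (dk (A j) *m psi) - dk (A j) *m (dk (A i) *m psi))
    - \sum_l (tor l i j)%:C *: (dk (A l) *m psi).
  rewrite /Om dkappawD // dkappawN // dkappaw_sum // dkappawD // dkappawD // dkappawN //.
  rewrite -dkappaw_commutator // !mulmxBl mulmxDl !mulmxBl !mulmxA; congr (_ - _).
  rewrite mulmx_suml; apply: eq_bigr => l _.
  by rewrite dkappawZ // scalemxAl.
have NE : \sum_l (A i l j)%:C *: N l - \sum_l (A j l i)%:C *: N l =
    H i j - H j i + \sum_l (tor l i j)%:C *: (dk (A l) *m psi).
  rewrite H_tor -sumrB -big_split; apply: eq_bigr => l _ /=.
  by rewrite -scalerBl -rmorphB -scalerDr.
have -> : X i j - X j i = DN i j + dk (A i) *m N j - (DN j i + dk (A j) *m N i)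
    - (\sum_l (A i l j)%:C *: N l - \sum_l (A j l i)%:C *: N l).
  by rewrite /X [in LHS]opprB addrACA opprB [- _ + _]addrC opprD [LHS]addrACA.
rewrite NE /DN /N !mulmxDr.
move: (\sum_l _) (dk (A i) *m P j) (dk (A j) *m P i) (H i j) (H j i) => s a b c d.
move: (dk (A i) *m _) (dk (A j) *m (_ *m _)) (dk (dA i j) *m _) (dk (dA j i) *m _).
by move=> e f g h; apply/matrixP => p q; rewrite !mxE; ring.
Qed.

Lemma weitzenboeck_at_point :
  \sum_i gam i *m (\sum_j gam j *m DN i j
                   + dkappaw gam (w - 1) (A i) *m \sum_j gam j *m N j) =
  - \sum_i X i i + (4^-1)%:C *: ((\sum_j \sum_i Om i j i j)%:C *: psi)
  + ((n%:R - 2 + 2 * w) / 4)%:C *: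
    \sum_i \sum_j (co_tr (Om i j))%:C *: (gam i *m (gam j *m psi)).
Proof.
rewrite dirac_square_hessian.
set S := \sum_j \sum_i Om i j i j; set Phi := \sum_i \sum_j _ *: _.
have two : 2 != 0 :> R[i] by rewrite pnatr_eq0.
have four : 4 != 0 :> R[i] by rewrite pnatr_eq0.
have PhiE : (\sum_i \sum_j (co_tr (Om i j))%:C *: (gam i *m gam j)) *m psi = Phi.
  rewrite /Phi mulmx_suml; apply: eq_bigr => i _; rewrite mulmx_suml.
  by apply: eq_bigr => j _; rewrite -scalemxAl mulmxA.
have curvE : 2 *: \sum_i \sum_j gam i *m gam j *m (X i j - X j i) =
    S%:C *: psi + (n%:R - 2 + 2 * w%:C) *: Phi.
  transitivity ((2 *: \sum_i \sum_j gam i *m gam j *m spin_rep gam (co_so (Om i j)))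
      *m psi + (2 * w%:C) *: Phi).
    rewrite -scalemxAl -scalerA -scalerDr; congr (_ *: _).
    rewrite mulmx_suml /Phi scaler_sumr -big_split; apply: eq_bigr => i _ /=.
    rewrite mulmx_suml scaler_sumr -big_split; apply: eq_bigr => j _ /=.
    rewrite hessian_commutator dkappawE // mulmxDl mulmxDr !mulmxA; congr (_ + _).
    by rewrite mul_mx_scalar -scalemxAl rmorphM -scalerA.
  rewrite (clifford_curvature n_gt0 hgam Om_anti Om_sym Om_bianchi).
  by rewrite mulmxDl mul_scalar_mx -scalemxAl PhiE [in RHS]scalerDl addrA.
have c1 : 4 * (4^-1)%:C = 1 :> R[i] by rewrite fmorphV rmorph_nat divff.
have c2 : 4 * ((n%:R - 2 + 2 * w) / 4)%:C = n%:R - 2 + 2 * w%:C :> R[i].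
  rewrite rmorphM rmorphD rmorphB rmorphM fmorphV !rmorph_nat.
  by rewrite mulrC divfK.
have four2 : 4 = 2 * 2 :> R[i] by rewrite -natrM.
apply: (scalerI four); rewrite [RHS]scalerDr [X in _ = X + _]scalerDr.
rewrite [4 *: (_ *: (_ *: psi))]scalerA c1 scale1r [4 *: (_ *: Phi)]scalerA c2.
rewrite {1}four2 -scalerA clifford_contract // scalerBr curvE scalerN.
by rewrite scalerA -four2 addrC addrA.
Qed.

End WeitzenboeckAtPoint.

(** * Derivatives of spinor fields *)

Section SpinorCalculus.
Variables (R : realType) (n : nat) (M : oriented_manifold R n).
Implicit Types (V : set M) (h : M -> R[i]) (v : tvec M).

Definition csmooth V h : Prop :=
  smooth_on V (fun y => complex.Re (h y)) /\ smooth_on V (fun y => complex.Im (h y)).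

Definition cder v h : R[i] :=
  v (fun y => complex.Re (h y)) +i* v (fun y => complex.Im (h y)).

Section AtPoint.
Variables (U : set M) (x : M) (v : tvec M).
Hypotheses (Uo : open U) (Ux : U x) (vx : tangent x v).

Let ReD (a b : R[i]) : complex.Re (a + b) = complex.Re a + complex.Re b.
Proof. by case: a b => [? ?] []. Qed.
Let ImD (a b : R[i]) : complex.Im (a + b) = complex.Im a + complex.Im b.
Proof. by case: a b => [? ?] []. Qed.
Let ReM (a b : R[i]) : complex.Re (a * b) =
  complex.Re a * complex.Re b - complex.Im a * complex.Im b.
Proof. by case: a b => [? ?] []. Qed.
Let ImM (a b : R[i]) : complex.Im (a * b) =
  complex.Re a * complex.Im b + complex.Im a * complex.Re b.
Proof. by case: a b => [? ?] []. Qed.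

Lemma csmooth_cst (a : R[i]) : csmooth U (fun _ => a).
Proof. by split; exact: smooth_on_cst. Qed.

Lemma csmooth_real (f : M -> R) : smooth_on U f -> csmooth U (fun y => (f y)%:C).
Proof. by move=> fs; split => //; exact: smooth_on_cst. Qed.

Lemma csmooth_add f g : csmooth U f -> csmooth U g -> csmooth U (fun y => f y + g y).
Proof.
move=> [fr fi] [gr gi]; split.
  by under eq_fun do rewrite ReD; exact: smooth_on_add.
by under eq_fun do rewrite ImD; exact: smooth_on_add.
Qed.

Lemma csmooth_mul f g : csmooth U f -> csmooth U g -> csmooth U (fun y => f y * g y).
Proof.
move=> [fr fi] [gr gi]; split.
  by under eq_fun do rewrite ReM; apply: smooth_on_sub_fun => //; exact: smooth_on_mul.
by under eq_fun do rewrite ImM; apply: smooth_on_add => //; exact: smooth_on_mul.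
Qed.

Lemma csmooth_sum (I : Type) (r : seq I) (F : I -> M -> R[i]) :
  (forall i, csmooth U (F i)) -> csmooth U (fun y => \sum_(i <- r) F i y).
Proof.
move=> Fs; elim: r => [|i r IH].
  by under eq_fun do rewrite big_nil; exact: csmooth_cst.
by under eq_fun do rewrite big_cons; exact: csmooth_add.
Qed.

Lemma cder_cst (a : R[i]) : cder v (fun _ => a) = 0.
Proof. by rewrite /cder !(tangent_cst Uo Ux vx). Qed.

Lemma cder_real (f : M -> R) : cder v (fun y => (f y)%:C) = (v f)%:C.
Proof. by rewrite /cder /= (tangent_cst Uo Ux vx). Qed.

Lemma cder_add f g : csmooth U f -> csmooth U g ->
  cder v (fun y => f y + g y) = cder v f + cder v g.
Proof.
move=> [fr fi] [gr gi]; rewrite /cder.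
under eq_fun do rewrite ReD; under [in X in _ +i* X]eq_fun do rewrite ImD.
by rewrite (tangent_add Uo Ux vx fr gr) (tangent_add Uo Ux vx fi gi).
Qed.

Lemma cder_mul f g : csmooth U f -> csmooth U g ->
  cder v (fun y => f y * g y) = cder v f * g x + f x * cder v g.
Proof.
move=> [fr fi] [gr gi]; rewrite /cder.
under eq_fun do rewrite ReM; under [in X in _ +i* X]eq_fun do rewrite ImM.
have sM a b := @smooth_on_mul _ _ M U a b Uo.
rewrite (tangent_sub Uo Ux vx (sM _ _ fr gr) (sM _ _ fi gi)).
rewrite (tangent_add Uo Ux vx (sM _ _ fr gi) (sM _ _ fi gr)).
rewrite !(tangent_mul Uo Ux vx) //.
case: (f x) (g x) => [a b] [c d] /=.
by apply/eqP; rewrite eq_complex /=; apply/andP; split; apply/eqP; ring.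
Qed.

Lemma cder_sum (I : Type) (r : seq I) (F : I -> M -> R[i]) :
  (forall i, csmooth U (F i)) ->
  cder v (fun y => \sum_(i <- r) F i y) = \sum_(i <- r) cder v (F i).
Proof.
move=> Fs; elim: r => [|i r IH].
  by under eq_fun do rewrite big_nil; rewrite big_nil cder_cst.
under eq_fun do rewrite big_cons.
by rewrite big_cons cder_add ?IH //; exact: csmooth_sum.
Qed.

Lemma der_spinor_add f g : smooth_spinor U f -> smooth_spinor U g ->
  der_spinor v (fun y => f y + g y) = der_spinor v f + der_spinor v g.
Proof.
move=> fs gs; apply/colP => k; rewrite !mxE.
rewrite -[RHS](cder_add (fs k) (gs k)); congr cder.
by apply/funext => y; rewrite mxE.
Qed.

Lemma smooth_spinor_add f g : smooth_spinor U f -> smooth_spinor U g ->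
  smooth_spinor U (fun y => f y + g y).
Proof.
move=> fs gs k; have := csmooth_add (fs k) (gs k).
by rewrite (_ : (fun y => _) = fun y => (f y + g y) k 0) //; apply/funext => y; rewrite mxE.
Qed.

Lemma smooth_spinor_mul (F : M -> spinor_mx R n) f :
  (forall k l, csmooth U (fun y => F y k l)) -> smooth_spinor U f ->
  smooth_spinor U (fun y => F y *m f y).
Proof.
move=> Fs fs k.
have : csmooth U (fun y => \sum_l F y k l * f y l 0).
  by apply: csmooth_sum => l; apply: csmooth_mul => //; exact: fs.
by rewrite (_ : (fun y => _) = fun y => (F y *m f y) k 0) //; apply/funext => y; rewrite mxE.
Qed.

Lemma der_spinor_mul (F : M -> spinor_mx R n) f :
  (forall k l, csmooth U (fun y => F y k l)) -> smooth_spinor U f ->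
  der_spinor v (fun y => F y *m f y) =
  (\matrix_(k, l) cder v (fun y => F y k l)) *m f x + F x *m der_spinor v f.
Proof.
move=> Fs fs; apply/colP => k; rewrite !mxE.
transitivity (cder v (fun y => \sum_l F y k l * f y l 0)).
  by congr cder; apply/funext => y; rewrite mxE.
rewrite cder_sum => [|l]; last by apply: csmooth_mul => //; exact: fs.
rewrite -big_split; apply: eq_bigr => l _ /=.
by rewrite !mxE cder_mul //; exact: fs.
Qed.

Lemma smooth_spinor_mulmx (F : spinor_mx R n) f : smooth_spinor U f ->
  smooth_spinor U (fun y => F *m f y).
Proof. by apply: smooth_spinor_mul => k l; exact: csmooth_cst. Qed.

Lemma der_spinor_mulmx (F : spinor_mx R n) f : smooth_spinor U f ->
  der_spinor v (fun y => F *m f y) = F *m der_spinor v f.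
Proof.
move=> fs; rewrite der_spinor_mul // => [|k l]; last exact: csmooth_cst.
rewrite (_ : \matrix_(_, _) _ = 0) ?mul0mx ?add0r //.
by apply/matrixP => k l; rewrite !mxE cder_cst.
Qed.

Lemma der_spinor_sum_mulmx (gam : 'I_n -> spinor_mx R n) (F : 'I_n -> M -> spinor R n) :
  (forall j, smooth_spinor U (F j)) ->
  der_spinor v (fun y => \sum_j gam j *m F j y) = \sum_j gam j *m der_spinor v (F j).
Proof.
move=> Fs; elim: (index_enum 'I_n) => [|j r IH].
  under eq_fun do rewrite big_nil.
  rewrite big_nil; apply/colP => k; rewrite !mxE /=.
  have := cder_cst 0; rewrite /cder /= => <-.
  by congr (v _ +i* v _); apply/funext => y; rewrite mxE.
under eq_fun do rewrite big_cons.
rewrite big_cons -IH -der_spinor_mulmx // -der_spinor_add //.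
  exact: smooth_spinor_mulmx.
elim: r {IH} => [|l r IH].
  under eq_fun do rewrite big_nil.
  move=> k; have := csmooth_cst 0.
  rewrite (_ : (fun _ => 0) = fun _ : M => (0 : spinor R n) k 0) //.
  by apply/funext => y; rewrite mxE.
under eq_fun do rewrite big_cons.
by apply: smooth_spinor_add => //; exact: smooth_spinor_mulmx.
Qed.

(* dkappaw is real-linear, so its entries are combinations of the entries of its
   argument with constant complex coefficients. *)
Section ConnectionTerm.
Variables (gam : 'I_n -> spinor_mx R n) (w : R) (A : M -> 'M[R]_n).
Hypotheses (n_gt0 : (0 < n)%N) (hgam : clifford_rep gam) (As : smooth_mx U A).
Local Notation dk := (dkappaw gam w).

Let dk_entry B p q :
  dk B p q = \sum_k \sum_l (B k l)%:C * dk (delta_mx k l) p q.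
Proof.
rewrite {1}(dkappaw_delta hgam w B) summxE; apply: eq_bigr => k _.
by rewrite summxE; apply: eq_bigr => l _; rewrite mxE.
Qed.

Let dk_smooth k l p q : csmooth U (fun y => (A y k l)%:C * dk (delta_mx k l) p q).
Proof. by apply: csmooth_mul; [exact: csmooth_real|exact: csmooth_cst]. Qed.

Lemma csmooth_dkappaw p q : csmooth U (fun y => dk (A y) p q).
Proof.
under eq_fun do rewrite dk_entry.
by apply: csmooth_sum => k; apply: csmooth_sum => l; exact: dk_smooth.
Qed.

Lemma cder_dkappaw :
  \matrix_(p, q) cder v (fun y => dk (A y) p q) = dk (der_mx v A).
Proof.
apply/matrixP => p q; rewrite mxE dk_entry.
under eq_fun do rewrite dk_entry.
rewrite cder_sum => [|k]; last by apply: csmooth_sum => l; exact: dk_smooth.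
apply: eq_bigr => k _; rewrite cder_sum //; apply: eq_bigr => l _.
rewrite cder_mul //; [|exact: csmooth_real|exact: csmooth_cst].
by rewrite cder_cst mulr0 addr0 cder_real [der_mx _ _ _ _]mxE.
Qed.

Lemma smooth_spinor_dkappaw f : smooth_spinor U f ->
  smooth_spinor U (fun y => dk (A y) *m f y).
Proof. by apply: smooth_spinor_mul; exact: csmooth_dkappaw. Qed.

Lemma der_spinor_dkappaw f : smooth_spinor U f ->
  der_spinor v (fun y => dk (A y) *m f y) =
  dk (der_mx v A) *m f x + dk (A x) *m der_spinor v f.
Proof.
by move=> fs; rewrite der_spinor_mul // ?cder_dkappaw //; exact: csmooth_dkappaw.
Qed.

End ConnectionTerm.
End AtPoint.

Lemma der_spinor_comb (b : 'I_n -> R) (u : 'I_n -> tvec M) (f : M -> spinor R n) :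
  der_spinor (fun t => \sum_l b l * u l t) f = \sum_l (b l)%:C *: der_spinor (u l) f.
Proof.
apply/colP => k; rewrite mxE summxE.
under [RHS]eq_bigr => l _ do rewrite !mxE.
elim: (index_enum 'I_n) => [|l r IH]; first by rewrite !big_nil.
rewrite !big_cons -IH; apply/eqP; rewrite eq_complex /=.
by apply/andP; split; apply/eqP; ring.
Qed.

End SpinorCalculus.

(** * The formula for spinor fields *)

Theorem theorem3p3 (R : realType) (n : nat) (n_gt0 : (0 < n)%N)
    (M : oriented_manifold R n) (c : set (metric M)) (hc : conformal_class c)
    (gam : 'I_n -> spinor_mx R n) (hgam : clifford_rep gam)
    (Q : cspin_structure c) (W : weyl_structure c)
    (g : metric M) (hg : c g) (w : R)
    (psi : Q -> spinor R n) (hpsi : spinor_section gam w psi)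
    (U : set M) (s : M -> Q) (hs : sec U s) (x : M) (hx : U x) :
  Dirac W gam (w - 1) (Dirac W gam w (components psi)) s x =
    spinor_laplacian W gam w (components psi) s x
    + (4^-1 : R)%:C *: scalS W (components psi) s x
    + ((n%:R - 2 + 2 * w) / 4)%:C *: faradayS W gam g (components psi) s x.
Proof.
pose e := cov_fr s; have eU : frame_field c U e := cov_smooth hs.
have Uo : open U by case: eU.
pose f y : spinor R n := psi (s y); have fs : smooth_spinor U f := hpsi.2 _ _ hs.
have ex i y : U y -> tangent y (e y i) := @frame_tangent _ _ _ _ _ _ eU y i.
pose A i y := frame_form W e i y.
have As i : smooth_mx U (A i) := smooth_frame_form W eU i.
pose P j y := der_spinor (e y j) f.
have Ps j : smooth_spinor U (P j).
  move=> k; have [fr fi] := fs k.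
  have sd h : smooth_on U h -> smooth_on U (fun y => e y j h).
    exact: (smooth_frame_der eU j Uo (@subset_refl _ U)).
  by split; under eq_fun do rewrite mxE /=; exact: sd.
pose H i j := der_spinor (e x i) (P j).
pose N j y := P j y + dkappaw gam w (A j y) *m f y.
have Ns j : smooth_spinor U (N j).
  by apply: smooth_spinor_add => //; exact: smooth_spinor_dkappaw.
have DN i j : der_spinor (e x i) (N j) =
    H i j + dkappaw gam w (der_mx (e x i) (A j)) *m f x
    + dkappaw gam w (A j x) *m P i x.
  rewrite (der_spinor_add Uo hx (ex i x hx)) //; last exact: smooth_spinor_dkappaw.
  by rewrite (der_spinor_dkappaw Uo hx (ex i x hx)) // addrA.
(* Second derivatives commute up to the bracket of the frame vectors. *)
have H_tor i j : H i j - H j i = \sum_l (bracket_coef W e l i j x)%:C *: P l x.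
  have comm h : smooth_on U h -> _ :=
    @frame_commutator _ _ _ _ W _ _ eU U x i j h Uo (@subset_refl _ U) hx.
  rewrite -der_spinor_comb; apply/colP => k; have [fr fi] := fs k.
  rewrite !mxE -(comm _ fr) -(comm _ fi).
  have E p q : e x p (fun y => complex.Re (P q y k 0)) =
      e x p (fun y => e y q (fun z => complex.Re (f z k 0))).
    by congr (e x p _); apply/funext => y; rewrite mxE.
  have E' p q : e x p (fun y => complex.Im (P q y k 0)) =
      e x p (fun y => e y q (fun z => complex.Im (f z k 0))).
    by congr (e x p _); apply/funext => y; rewrite mxE.
  by rewrite !E !E'.
have trE i j := co_tr_curv_form W eU n_gt0 i j hx.
have Om_sym i j k l : curv_form W e i j x k l + curv_form W e i j x l k =
    2 * co_tr (curv_form W e i j x) * (k == l)%:R.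
  by rewrite trE (curv_form_sym W eU).
have co_A i : co_lie (A i x) := cform_co W eU hx (ex i x hx).
have Om_bianchi i j k m := first_bianchi W eU hc hg i j k m hx.
have diracE : Dirac W gam (w - 1) (Dirac W gam w (components psi)) s x =
    \sum_i gam i *m (\sum_j gam j *m (H i j
          + dkappaw gam w (der_mx (e x i) (A j)) *m f x
          + dkappaw gam w (A j x) *m P i x)
        + dkappaw gam (w - 1) (A i x) *m \sum_j gam j *m N j x).
  rewrite /Dirac; apply: eq_bigr => i _; congr (_ *m _).
  under eq_bigr => j _ do rewrite -DN.
  by rewrite -(der_spinor_sum_mulmx Uo hx (ex i x hx)).
have lapE : spinor_laplacian W gam w (components psi) s x =
    - \sum_i (H i i + dkappaw gam w (der_mx (e x i) (A i)) *m f x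
      + dkappaw gam w (A i x) *m P i x + dkappaw gam w (A i x) *m N i x
      - \sum_l (A i x l i)%:C *: N l x).
  rewrite /spinor_laplacian; congr (- _); apply: eq_bigr => i _.
  rewrite -DN /covTS vf_of_bas; congr (_ - _); rewrite /covS.
  rewrite (_ : vf_of _ _ x = fun t => \sum_l A i x l i * e x l t); last first.
    apply/funext => t; apply: eq_bigr => l _.
    by rewrite (covT_bas W eU i hx (ex i x hx)) mxE.
  rewrite (conn_comb W eU _ hx) der_spinor_comb dkappaw_sum // mulmx_suml -big_split.
  by apply: eq_bigr => l _ /=; rewrite dkappawZ // -scalemxAl -scalerDr.
have scalE : scalS W (components psi) s x =
    (\sum_j \sum_i curv_form W e i j x i j)%:C *: f x.
  rewrite /scalS /scal /Ric; congr (_%:C *: _); apply: eq_bigr => j _.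
  by apply: eq_bigr => i _; rewrite (Riem_curv_form W eU).
have farE : faradayS W gam g (components psi) s x =
    \sum_i \sum_j (co_tr (curv_form W e i j x))%:C *: (gam i *m (gam j *m f x)).
  apply: eq_bigr => i _; apply: eq_bigr => j _.
  by rewrite (faraday_curv_trace W eU n_gt0 hc hg) // trE.
rewrite diracE lapE scalE farE.
exact: (weitzenboeck_at_point n_gt0 hgam w (f x) co_A H_tor Om_sym Om_bianchi).
Qed.
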